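(* Let $p\ge 3$ and let $\phi:[0,\infty)\to\mathbb{R}$ be differentiable with $\phi(w)<p-2$ for all $w> 0$, and consider the estimator $\hat\theta_\phi(X)=\bigl(1-\phi(\|X\|^2)/\|X\|^2\bigr)X$. Assume: (A.1) $\phi'(w)\ge 0$ for all $w\ge 0$; (A.2) $\phi(w)\ge 0$ for all $w\ge 0$; (A.4) $\lim_{w\to\infty}\phi(w)=p-2$; (A.6) the function $w\mapsto w\phi'(w)/\{p-2-\phi(w)\}^2$ is monotone non-decreasing on $(0,\infty)$; (A.7) $R(0,\hat\theta_{\mathrm{JS}})\ge R(0,\hat\theta_\phi)$ (dominance at the origin). Then $\hat\theta_\phi$ dominates the James--Stein estimator, i.e. $R(\theta,\hat\theta_\phi)\le R(\theta,\hat\theta_{\mathrm{JS}})$ for all $\theta\in\mathbb{R}^p$.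
   Context: Let $X\sim\mathcal{N}_p(\theta,I_p)$ with $\theta\in\mathbb{R}^p$, $p\ge 3$. The loss is quadratic, and the risk of an estimator $\hat\theta$ is $R(\theta,\hat\theta)=\mathrm{E}_\theta[\|\hat\theta(X)-\theta\|^2]$. The James--Stein estimator is $\hat\theta_{\mathrm{JS}}(X)=\bigl(1-(p-2)/\|X\|^2\bigr)X$. For a function $\phi$ on $[0,\infty)$, $\hat\theta_\phi(X)=\bigl(1-\phi(\|X\|^2)/\|X\|^2\bigr)X$. *)

(* Defs.v *)
From HB Require Import structures.
From mathcomp Require Import all_boot all_order all_algebra.
From mathcomp Require Import all_classical all_reals all_analysis.
Set Implicit Arguments. Unset Strict Implicit. Unset Printing Implicit Defensive.
Import Order.TTheory GRing.Theory Num.Theory.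
Import numFieldNormedType.Exports.
Local Open Scope classical_set_scope.
Local Open Scope ring_scope.

Section JS.
Context {R : realType} (p : nat).

Definition sqnorm (x : 'rV[R]_p) : R := \sum_(i < p) x 0 i ^+ 2.

(* theta_phi(X) = (1 - phi(|X|^2)/|X|^2) X  (at X = 0, MathComp's 0^-1 = 0
   gives X; a null set, irrelevant for the risk) *)
Definition est_phi (phi : R -> R) (x : 'rV[R]_p) : 'rV[R]_p :=
  (1 - phi (sqnorm x) / sqnorm x) *: x.

Definition est_JS : 'rV[R]_p -> 'rV[R]_p := est_phi (fun _ => (p - 2)%:R).

Definition upd (v : nat -> R) (i : nat) (x : R) : nat -> R :=
  fun j => if j == i then x else v j.

(* iterated integral of f against the product of the N(th j, 1) laws,
   j = 0 .. n-1 (the law of a vector with independent N(th j,1) coords) *)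
Fixpoint iter_gauss (th : nat -> R) (n : nat) (f : (nat -> R) -> \bar R)
  : \bar R :=
  match n with
  | 0 => f (fun _ => 0)
  | n'.+1 => (\int[normal_prob (th n') 1]_x
                iter_gauss th n' (fun v => f (upd v n' x)))%E
  end.

Definition coords (theta : 'rV[R]_p) (j : nat) : R :=
  match @insub nat (fun j => j < p)%N 'I_p j with
  | Some i => theta 0 i | None => 0 end.

(* E_theta[ g(X) ] for X ~ N_p(theta, I_p), g nonnegative (extended-real) *)
Definition gauss_expect (theta : 'rV[R]_p) (g : 'rV[R]_p -> \bar R) : \bar R :=
  iter_gauss (coords theta) p (fun v => g (\row_(i < p) v i)).

Definition risk (theta : 'rV[R]_p) (d : 'rV[R]_p -> 'rV[R]_p) : \bar R :=
  gauss_expect theta (fun x => (sqnorm (d x - theta))%:E).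

End JS.

(* Main.v *)
Require Import Defs.
From HB Require Import structures.
From mathcomp Require Import all_boot all_order all_algebra.
From mathcomp Require Import all_classical all_reals all_analysis.
From mathcomp Require Import measurable_realfun ring lra.
Set Implicit Arguments.
Unset Strict Implicit.
Unset Printing Implicit Defensive.
Import Order.TTheory GRing.Theory Num.Theory.
Import numFieldNormedType.Exports.
Local Open Scope classical_set_scope.
Local Open Scope ring_scope.

(* By Stein's identity, the risk of the James-Stein estimator exceeds that of the
   estimator given by phi by E[gain(|X|^2)], gain w = 4 phi'(w) - (p-2-phi w)^2 / w.
   By (A.6) the gain changes sign at most once, from negative to nonnegative, and
   the law of |X| has monotone likelihood ratio with respect to its central law:
   the ratio is an average of cosh(r <s, theta>) over the directions s.  Hence the
   expected gain is nonnegative for every theta as soon as it is for theta = 0.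

   In polar coordinates, Stein's identity says that the integral of a derivative
   along each ray vanishes.  This needs phi' to be continuous, which (A.6) provides:
   1 / (p - 2 - phi (exp t)) is differentiable with a nondecreasing derivative. *)

Local Notation half_line R := (`]0%R, +oo[%classic : set R).

Section real_measurability.
Context {R : realType} d (T : measurableType d).
Implicit Types f : T -> R.

Lemma measurable_patch_open (D : set R) (g : R -> R) : open D ->
  {in D, continuous g} -> measurable_fun [set: R] (g \_ D).
Proof.
move=> oD cg; apply/(measurable_restrictT _ (open_measurable oD)).
exact: open_continuous_measurable_fun.
Qed.

Lemma measurable_funV f : measurable_fun setT f ->
  measurable_fun setT (fun t => (f t)^-1).
Proof.
move=> mf; apply: (measurableT_comp (f := @GRing.inv R)) => //.
have -> : @GRing.inv R = @GRing.inv R \_ [set~ 0].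
  apply/funext => x; rewrite patchE; case: ifPn => // /negP.
  by rewrite inE/= => /contrapT ->; rewrite invr0.
apply: measurable_patch_open => [|x].
  by apply: closed_openC; exact: closed_eq.
by rewrite inE/= => /eqP; exact: inv_continuous.
Qed.

Lemma measurable_fun_sqrt f : measurable_fun setT f ->
  measurable_fun setT (fun t => Num.sqrt (f t)).
Proof.
move=> mf; apply: (measurableT_comp (f := @Num.sqrt R)) => //.
by apply: continuous_measurable_fun; exact: sqrt_continuous.
Qed.

Lemma measurable_fun_expR f : measurable_fun setT f ->
  measurable_fun setT (fun t => expR (f t)).
Proof. exact: measurableT_comp. Qed.

End real_measurability.

(** * Measurability of families *)

Definition family_display : Type -> measure_display -> measure_display.
Proof. exact. Qed.

Definition family_cylinders (I : Type) d (T : measurableType d) : set (set (I -> T)) :=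
  \bigcup_i preimage_set_system setT (fun v : I -> T => v i) measurable.

HB.instance Definition _ (I : Type) d (T : measurableType d) :=
  @isMeasurable.Build (family_display I d) (I -> T) <<s @family_cylinders I d T >>
    (@sigma_algebra0 _ setT _) (@sigma_algebraC _ _) (@sigma_algebra_bigcup _ setT _).

Section measurable_family.
Context {I : Type} d d' {T : measurableType d} {T' : measurableType d'}.
Implicit Types (X : T -> I -> T') (i : I).

Lemma measurable_proj i : measurable_fun [set: I -> T'] (fun v => v i).
Proof.
move=> _ A mA; rewrite setTI; apply: sub_sigma_algebra.
by exists i => //; exists A; rewrite ?setTI.
Qed.

Lemma measurable_familyP X :
  measurable_fun setT X <-> forall i, measurable_fun setT (fun t => X t i).
Proof.
split=> [mX i|mX]; first exact: (measurableT_comp (measurable_proj i) mX).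
apply: (@measurability _ _ _ _ _ _ (@family_cylinders I d' T')) => //.
move=> _ [_ [i _ [A mA <-]] <-]; rewrite !setTI -comp_preimage.
by rewrite -[_ @^-1` _]setTI; exact: mX.
Qed.

End measurable_family.

(** * Integration on the half-line *)

Section half_line.
Context {R : realType}.
Implicit Types r : R.

Lemma half_lineE r : half_line R r = (0 < r) :> Prop.
Proof. by rewrite /= in_itv/= andbT. Qed.

Lemma mem_half_line r : (r \in half_line R) = (0 < r).
Proof. by apply/idP/idP; rewrite inE half_lineE. Qed.

End half_line.

Section integral_dilation.
Context {R : realType}.
Local Notation mu := (@lebesgue_measure R).
Local Open Scope ereal_scope.
Implicit Types (r : R) (f : R -> \bar R).

Let mulr_measurable r : measurable_fun [set: measurableTypeR R]
  ( *%R r : measurableTypeR R -> measurableTypeR R).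
Proof. exact: measurable_funM. Qed.

Lemma lebesgue_measure_dilation_gt0 r (A : set R) : (0 < r)%R -> measurable A ->
  r%:E * mu ( *%R r @^-1` A) = mu A.
Proof.
move=> r0 mA.
have -> : r%:E * mu ( *%R r @^-1` A) = mscale (NngNum (ltW r0)) (pushforward mu
  ( *%R r : measurableTypeR R -> measurableTypeR R)) A by [].
apply/esym/lebesgue_measure_unique => //= _ [[a b]] _ <-.
rewrite /mscale/= /pushforward/= lebesgue_measure_itv/=.
have -> : *%R r @^-1` `]a, b] = `](a / r)%R, (b / r)%R]%classic.
  apply/seteqP; split => x /=;
  by rewrite !in_itv/= ltr_pdivrMr// ler_pdivlMr// [(x * r)%R]mulrC.
rewrite lebesgue_measure_itv/= !lte_fin ltr_pM2r ?invr_gt0//.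
case: ifPn => _; last by rewrite mule0.
by rewrite -!EFinB -EFinM -mulrBl mulrCA mulfV ?mulr1// gt_eqF.
Qed.

Lemma lebesgue_measure_dilation r (A : set R) : r != 0%R -> measurable A ->
  `|r|%:E * mu ( *%R r @^-1` A) = mu A.
Proof.
rewrite neq_lt => /orP[r0|r0] mA; last first.
  by rewrite gtr0_norm// lebesgue_measure_dilation_gt0.
have -> : *%R r @^-1` A = *%R (- r) @^-1` ( -%R @^-1` A).
  by apply/seteqP; split => x /=; rewrite mulNr opprK.
rewrite ltr0_norm// lebesgue_measure_dilation_gt0 ?oppr_gt0//.
  exact: lebesgue_measureN.
by rewrite -[X in measurable X]setTI; exact: measurable_funN.
Qed.

Lemma ge0_integral_dilation r f : r != 0%R ->
  measurable_fun [set: R] f -> (forall x, 0 <= f x) ->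
  \int[mu]_x f x = `|r|%:E * \int[mu]_x f (r * x)%R.
Proof.
move=> r0 mf f0.
have := ge0_integral_pushforward (mulr_measurable r) mu measurableT mf (fun x _ => f0 x).
rewrite preimage_setT /= => <-.
rewrite -(ge0_integral_mscale _ measurableT (NngNum (normr_ge0 r)))//.
apply: eq_measure_integral => A mA _ /=.
by rewrite -(lebesgue_measure_dilation r0 mA).
Qed.

Lemma ge0_integral0y_dilation r f : (0 < r)%R ->
  measurable_fun (half_line R) f -> (forall x : R, (0 < x)%R -> 0 <= f x) ->
  \int[mu]_(x in half_line R) f x = r%:E * \int[mu]_(x in half_line R) f (r * x)%R.
Proof.
move=> r0 mf f0; rewrite integral_mkcond (@ge0_integral_dilation r); last 3 first.
- by rewrite gt_eqF.
- exact/(measurable_restrictT f (measurable_itv _)).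
- by move=> x; apply: erestrict_ge0 => {}x; rewrite half_lineE; exact: f0.
rewrite gtr0_norm//; congr (_ * _); rewrite [RHS]integral_mkcond.
by apply: eq_integral => x _; rewrite !patchE !mem_half_line pmulr_rgt0.
Qed.

End integral_dilation.

Section fubini_tonelli_in.
Context d d' (T : measurableType d) (T' : measurableType d') {R : realType}.
Variables (m : {sigma_finite_measure set T -> \bar R})
  (m' : {sigma_finite_measure set T' -> \bar R}).
Variables (D : set T') (f : T * T' -> \bar R).
Hypotheses (mD : measurable D) (mf : measurable_fun setT f)
  (f0 : forall t x, D x -> (0 <= f (t, x))%E).
Local Open Scope ereal_scope.

Let restricted z := if z.2 \in D then f z else 0.

Let measurable_restricted : measurable_fun setT restricted.
Proof.
apply: measurable_fun_ifT => //; apply: (measurable_fun_bool true).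
rewrite setTI (_ : _ @^-1` _ = setT `*` D); first exact: measurableX.
by apply/seteqP; split => z /=; [move/set_mem|move=> [_ /mem_set]].
Qed.

Let restricted_ge0 z : 0 <= restricted z.
Proof. by rewrite /restricted; case: z => t x; case: ifP => //= /set_mem/f0. Qed.

Let integral_restricted t : \int[m']_(x in D) f (t, x) = \int[m']_x restricted (t, x).
Proof. by rewrite integral_mkcond; apply: eq_integral => x _; rewrite patchE. Qed.

Lemma measurable_fun_integral_in :
  measurable_fun setT (fun t => \int[m']_(x in D) f (t, x)).
Proof.
under eq_fun do rewrite integral_restricted.
exact: (measurable_fun_fubini_tonelli_F (m2 := m') restricted).
Qed.

Lemma fubini_tonelli_in :
  \int[m]_t \int[m']_(x in D) f (t, x) = \int[m']_(x in D) \int[m]_t f (t, x).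
Proof.
under eq_integral do rewrite integral_restricted.
rewrite (fubini_tonelli (m1 := m) (m2 := m') restricted)// [RHS]integral_mkcond.
apply: eq_integral => x _; rewrite patchE /restricted/=.
by case: ifP => // _; rewrite integral0.
Qed.

End fubini_tonelli_in.

Lemma integral_probability_cst d (T : measurableType d) {R : realType}
    (P : probability T R) (k : \bar R) : (\int[P]_t k = k)%E.
Proof. by rewrite integral_cst//= probability_setT mule1. Qed.

Section primitive.
Context {R : realType}.
Local Notation mu := (@lebesgue_measure R).
Implicit Types (u v f g F H : R -> R) (r : R).

Lemma is_derive1_continuous f (x a : R) : is_derive x 1 f a -> {for x, continuous f}.
Proof. by move=> [fx _]; apply: differentiable_continuous; exact/derivable1_diffP. Qed.

(* A derivative has the intermediate value property, so it cannot jump; the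
   mean value theorem makes this quantitative. *)
Lemma nondecreasing_derive_continuous F f :
  (forall x : R, is_derive x 1 F (f x)) -> {homo f : x y / x <= y} -> continuous f.
Proof.
move=> dF ndf x; have mean_value (y z : R) : y < z ->
    exists2 c, y < c < z & F z - F y = f c * (z - y).
  move=> yz; have [|c] := @MVT _ F f y z yz _.
    by apply: continuous_subspaceT => t; exact: is_derive1_continuous (dF t).
  by rewrite in_itv/= => cyz Fc; exists c.
have quotient_cvg : h^-1 * (F (h + x) - F x) @[h --> 0^'] --> f x.
  have [dFx <-] := dF x; have /cvg_ex[l Fl] := dFx.
  rewrite /derive (cvg_lim _ Fl)//; apply: cvg_trans Fl; apply: near_eq_cvg.
  by apply: nearW => h /=; rewrite [h *: 1]mulr1.
rewrite /continuous_at; apply/cvgrPdist_lt => e e0.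
have /cvgrPdist_lt /(_ e e0)[/= d d0 near_quotient] := quotient_cvg.
pose h := d / 2; have h0 : 0 < h by rewrite divr_gt0.
have hd : h < d by rewrite /h; lra.
have [c /andP[xc _] Fc] := mean_value x (x + h) ltac:(lra).
have [c' /andP[_ c'x] Fc'] := mean_value (x - h) x ltac:(lra).
have fc : f c < f x + e.
  have := near_quotient h; rewrite /= sub0r normrN gtr0_norm// => /(_ hd (lt0r_neq0 h0)).
  have -> : h^-1 * (F (h + x) - F x) = f c.
    by rewrite [h + x]addrC Fc; field; rewrite gt_eqF.
  by rewrite ltr_norml => /andP[+ _]; lra.
have fc' : f x - e < f c'.
  have := near_quotient (- h); rewrite /= opprK add0r gtr0_norm// oppr_eq0.
  move=> /(_ hd (lt0r_neq0 h0)).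
  have -> : (- h)^-1 * (F (- h + x) - F x) = f c'.
    by rewrite [- h + x]addrC -[F (x - h) - F x]opprB Fc'; field; rewrite gt_eqF.
  by rewrite ltr_norml => /andP[_ +]; lra.
near=> y.
have c'y : c' <= y by apply: ltW; near: y; exact: lt_nbhsr.
have yc : y <= c by apply: ltW; near: y; exact: lt_nbhsl.
have := ndf _ _ c'y; have := ndf _ _ yc.
by rewrite ltr_norml => fyc fc'y; apply/andP; split; lra.
Unshelve. all: by end_near. Qed.

Lemma integral_segment_primitive u v H (a b : R) : a < b ->
  {within `[a, b], continuous u} -> {within `[a, b], continuous v} ->
  (forall r, r \in `[a, b] -> is_derive r 1 H (v r - u r)) ->
  (\int[mu]_(r in `[a, b]) (v r)%:E =
   \int[mu]_(r in `[a, b]) (u r)%:E + (H b - H a)%:E)%E.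
Proof.
move=> ab cu cv dH.
have integrable_segment g : {within `[a, b], continuous g} ->
    mu.-integrable `[a, b] (EFin \o g).
  by move=> cg; apply: continuous_compact_integrable => //; exact: segment_compact.
have cvu : {within `[a, b], continuous (fun r => v r - u r)}.
  by move=> r; apply: cvgB; [exact: cv|exact: cu].
have inab x : x \in `]a, b[ -> x \in `[a, b].
  by apply: subset_itvW; exact: lexx.
have cH x : x \in `[a, b] -> {for x, continuous H}.
  by move=> /dH; exact: is_derive1_continuous.
have -> : ((H b - H a)%:E = \int[mu]_(r in `[a, b]) (v r - u r)%:E)%E.
  rewrite (@continuous_FTC2 _ (fun r => v r - u r) H)//.
    split; first by move=> x /inab/dH[].
    - by apply: cvg_at_right_filter; apply: cH; rewrite in_itv/= lexx ltW.
    - by apply: cvg_at_left_filter; apply: cH; rewrite in_itv/= lexx ltW.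
  by move=> x /inab/dH[_ <-]; rewrite derive1E.
rewrite -integralD//; [|exact: integrable_segment..].
by apply: eq_integral => r _; rewrite -EFinD addrC subrK.
Qed.

Definition exhaustion n : set R := `[n.+1%:R^-1 : R, n.+2%:R]%classic.

Lemma exhaustion_gt0 n r : exhaustion n r -> 0 < r.
Proof.
by rewrite /exhaustion/= in_itv/= => /andP[+ _]; apply: lt_le_trans; rewrite invr_gt0.
Qed.

Lemma bigcup_exhaustion : half_line R = \bigcup_n exhaustion n.
Proof.
apply/seteqP; split => [x|x [n _ /exhaustion_gt0 x0]]; last by rewrite half_lineE.
rewrite half_lineE => x0.
exists (maxn (Num.truncn x) (Num.truncn x^-1)) => //; rewrite /exhaustion/= in_itv/=.
apply/andP; split.
  rewrite invf_ple ?posrE// ltW// (lt_le_trans (truncnS_gt _))// ler_nat.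
  by rewrite ltnS leq_maxr.
by rewrite ltW// (lt_le_trans (truncnS_gt _))// ler_nat ltnW// !ltnS leq_maxl.
Qed.

Lemma cvg_integral_exhaustion (f : R -> \bar R) :
  measurable_fun (half_line R) f -> (forall r, 0 < r -> (0 <= f r)%E) ->
  (\int[mu]_(r in exhaustion n) f r)%E @[n --> \oo] -->
  (\int[mu]_(r in half_line R) f r)%E.
Proof.
move=> mf f0; rewrite bigcup_exhaustion.
apply: ge0_nondecreasing_set_cvg_integral.
- apply/nondecreasing_seqP => n; rewrite subsetEset; apply: subset_itv.
    by rewrite bnd_simp lef_pV2 ?posrE// ler_nat.
  by rewrite bnd_simp ler_nat.
- by move=> n; exact: measurable_itv.
- move=> n; apply: measurable_funS mf => // r /exhaustion_gt0 r0.
  by rewrite half_lineE.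
- by move=> n r /exhaustion_gt0; exact: f0.
Qed.

Lemma eq_integral_half_line_primitive u v H :
  (forall r, 0 < r -> 0 <= u r) -> (forall r, 0 < r -> 0 <= v r) ->
  (forall r, 0 < r -> {for r, continuous u}) ->
  (forall r, 0 < r -> {for r, continuous v}) ->
  (forall r : R, 0 < r -> is_derive r 1 H (v r - u r)) ->
  H x @[x --> 0^'+] --> 0 -> H x @[x --> +oo] --> 0 ->
  (\int[mu]_(r in half_line R) (u r)%:E = \int[mu]_(r in half_line R) (v r)%:E)%E.
Proof.
move=> u0 v0 cu cv dH H0 Hy.
have within_exhaustion n g : (forall r, 0 < r -> {for r, continuous g}) ->
    {within exhaustion n, continuous g}.
  by move=> cg; apply: continuous_in_subspaceT => r /[!inE] /exhaustion_gt0/cg.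
have lt_ends n : n.+1%:R^-1 < n.+2%:R :> R.
  by apply: (@le_lt_trans _ _ 1); rewrite ?invf_le1 ?ler1n ?ltr1n.
have cvg_boundary : (H n.+2%:R - H n.+1%:R^-1)%:E @[n --> \oo] --> (0 : \bar R).
  apply: cvg_EFin; first exact: nearW.
  rewrite -[X in _ --> X](subr0 0); apply: cvgB.
    apply: (cvg_comp (fun n => n.+2%:R : R) H _ Hy).
    apply/cvgryPge => A; near=> n; apply: (@le_trans _ _ n%:R).
      by near: n; exact: nbhs_infty_ger.
    by rewrite ler_nat -addn2 leq_addr.
  apply: (cvg_at_rightP _ _ _).1 H0 _ _; split; first by move=> n; rewrite invr_gt0.
  exact: cvg_harmonic.
have measurable_half_line g : (forall r, 0 < r -> {for r, continuous g}) ->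
    measurable_fun (half_line R) (EFin \o g).
  move=> cg; apply/measurable_EFinP; apply: open_continuous_measurable_fun => //.
  by move=> r; rewrite mem_half_line; exact: cg.
have cvgu := cvg_integral_exhaustion (measurable_half_line u cu) u0.
have cvgv := cvg_integral_exhaustion (measurable_half_line v cv) v0.
apply: (cvg_unique _ _ cvgv) => //; rewrite /= -[X in _ --> X]adde0.
under eq_fun do rewrite (integral_segment_primitive (lt_ends _)
  (within_exhaustion _ _ cu) (within_exhaustion _ _ cv)
  (fun r rn => dH r (exhaustion_gt0 rn))).
apply: cvgeD => //.
by rewrite fin_num_adde_defl.
Unshelve. all: by end_near. Qed.

End primitive.

Lemma mule_eq1_gt0_lty {R : realDomainType} (x y : \bar R) :
  (0 <= x -> 0 <= y -> x * y = 1 -> 0 < x < +oo)%E.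
Proof.
rewrite le_eqVlt => /orP[/eqP<- _|x0].
  by rewrite mul0e => -[] /eqP; rewrite eq_sym oner_eq0.
rewrite x0 le_eqVlt => /orP[/eqP<-|y0].
  by rewrite mule0 => -[] /eqP; rewrite eq_sym oner_eq0.
by case: x x0 => [x| |]// _ ; rewrite ?ltry// gt0_mulye.
Qed.

Lemma pmule_inj {R : realDomainType} (a : R) : 0 < a -> injective (mule a%:E).
Proof.
move=> a0 x y axy; have le_axy := @lee_pmul2l R a%:E isT a0.
by apply: le_anti; rewrite -(le_axy x y) -(le_axy y x) axy lexx.
Qed.

Lemma pmule_lty {R : realDomainType} (a : R) (x : \bar R) :
  0 < a -> (a%:E * x < +oo -> x < +oo)%E.
Proof.
by move=> a0; case: x => [x| |] //; rewrite ?ltry ?ltNye// gt0_muley ?lte_fin.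
Qed.

Lemma lee_adde_eqE {R : realDomainType} (x y z t : \bar R) :
  (0 <= x -> 0 <= y -> 0 <= z -> 0 <= t ->
   x + z = y + t -> y + t < +oo -> (x <= y) = (t <= z))%E.
Proof.
case: x y z t => [x| |] [y| |] [z| |] [t| |]//= _ _ _ _; rewrite -?EFinD.
by case=> e _; rewrite !lee_fin; apply/idP/idP; lra.
Qed.

Section exponential_bounds.
Context {R : realType}.
Local Notation mu := (@lebesgue_measure R).
Implicit Types x y r a b : R.

Lemma ler_expRDexpRN x y : `|x| <= `|y| ->
  expR x + expR (- x) <= expR y + expR (- y).
Proof.
have even (z : R) : expR z + expR (- z) = expR `|z| + expR (- `|z|).
  by have [z0|z0] := leP 0 z; [rewrite ger0_norm|rewrite ltr0_norm// opprK addrC].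
rewrite (even x) (even y); move: `|x| `|y| (normr_ge0 x) => {}x {}y x0 xy.
rewrite -subr_ge0.
have -> : expR y + expR (- y) - (expR x + expR (- x)) =
    (expR y - expR x) * (1 - expR (- x) * expR (- y)).
  by rewrite !expRN; field; rewrite !gt_eqF ?expR_gt0.
by rewrite mulr_ge0 ?subr_ge0 ?ler_expR// -expRD -expR0 ler_expR; lra.
Qed.

Lemma exprn_le_fact_expR n r : 0 <= r -> r ^+ n <= n`!%:R * expR r.
Proof.
move=> r0; case: n => [|n].
  by rewrite expr0 fact0 mul1r -expR0 ler_expR.
rewrite -ler_pdivrMl ?ltr0n ?fact_gt0// mulrC.
by apply: le_trans (expR_ge1Dxn n r0); rewrite lerDr.
Qed.

Lemma integral_expRN : (\int[mu]_(r in half_line R) (expR (- r))%:E = 1)%E.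
Proof.
rewrite -[RHS](@integral_exponential_pdf R 1)//.
rewrite integral_itv_obnd_cbnd; last first.
  by apply/measurable_EFinP/measurable_funTS; exact: measurableT_comp.
rewrite integral_mkcond; apply: eq_integral => r _.
rewrite /exponential_pdf !patchE; case: ifP => // _.
by rewrite /exponential_pdf mul1r mulN1r.
Qed.

End exponential_bounds.

Section single_crossing.
Context {R : realType}.
Variable mu : {measure set (measurableTypeR R) -> \bar R}.
Variables (a : R) (h : R -> R) (l : R -> \bar R).
Hypothesis mh : measurable_fun [set: R] h.
Hypothesis ml : measurable_fun [set: R] l.
Hypothesis l_ge0 : forall r, (0 <= l r)%E.
Hypothesis l_nondecreasing : forall r s : R, a <= r -> r <= s -> (l r <= l s)%E.
Local Open Scope ereal_scope.
Local Notation D := (`]a, +oo[%classic : set R).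
Hypothesis integral_funrneg_le :
  \int[mu]_(r in D) (h^\-%R r)%:E <= \int[mu]_(r in D) (h^\+%R r)%:E.

Let mhp : measurable_fun D (EFin \o h^\+%R).
Proof. by apply/measurable_EFinP/measurable_funTS/measurable_funrpos. Qed.

Let mhn : measurable_fun D (EFin \o h^\-%R).
Proof. by apply/measurable_EFinP/measurable_funTS/measurable_funrneg. Qed.

Let mlD : measurable_fun D l.
Proof. exact: measurable_funTS. Qed.

Lemma le_integral_funrnegM_crossing (c : R) : (a <= c)%R ->
  (forall r, (a < r < c)%R -> (h r <= 0)%R) -> (forall r, (c < r)%R -> (0 <= h r)%R) ->
  \int[mu]_(r in D) ((h^\-%R r)%:E * l r) <= \int[mu]_(r in D) ((h^\+%R r)%:E * l r).
Proof.
move=> ac h_le0 h_ge0.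
have hp0 r : 0 <= (h^\+%R r)%:E by rewrite lee_fin funrpos_ge0.
have hn0 r : 0 <= (h^\-%R r)%:E by rewrite lee_fin funrneg_ge0.
apply: (@le_trans _ _ (\int[mu]_(r in D) ((h^\-%R r)%:E * l c))).
  apply: ge0_le_integral => //.
  - by move=> r _; rewrite mule_ge0.
  - exact: emeasurable_funM.
  - exact: emeasurable_funM.
  move=> r; rewrite /= in_itv/= andbT => ar; have [rc|cr] := leP r c.
    by rewrite lee_wpmul2l// l_nondecreasing// ltW.
  by rewrite (@ge0_funrnegE _ _ [set r]) ?inE//= ?mul0e// => _ ->; exact: h_ge0.
apply: (@le_trans _ _ (\int[mu]_(r in D) ((h^\+%R r)%:E * l c))).
  by rewrite !ge0_integralZr// lee_wpmul2r.
apply: ge0_le_integral => //.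
- by move=> r _; rewrite mule_ge0.
- exact: emeasurable_funM.
- exact: emeasurable_funM.
move=> r; rewrite /= in_itv/= andbT => ar; have [cr|rc] := leP c r.
  by rewrite lee_wpmul2l// l_nondecreasing.
by rewrite (@le0_funrposE _ _ [set r]) ?inE//= ?mul0e// => _ ->; rewrite h_le0 ?ar.
Qed.

Lemma le_integral_funrnegM_no_crossing : (forall r, (a < r)%R -> (h r <= 0)%R) ->
  \int[mu]_(r in D) ((h^\-%R r)%:E * l r) <= \int[mu]_(r in D) ((h^\+%R r)%:E * l r).
Proof.
move=> h_le0; have hp0 : \int[mu]_(r in D) (h^\+%R r)%:E = 0.
  apply: integral0_eq => r; rewrite /= in_itv/= andbT => ar.
  by rewrite (@le0_funrposE _ _ [set r]) ?inE//= => _ ->; exact: h_le0.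
have hn0 : ae_eq mu D (EFin \o h^\-%R) (cst 0).
  apply/ae_eq_integral_abs => //; apply/eqP; rewrite eq_le.
  under eq_integral do rewrite gee0_abs ?lee_fin ?funrneg_ge0//.
  rewrite -[X in _ <= X]hp0 integral_funrneg_le/= integral_ge0// => r _.
  by rewrite lee_fin funrneg_ge0.
rewrite (@ge0_ae_eq_integral _ _ _ _ _ _ (cst 0))//.
- by rewrite integral0 integral_ge0// => r _; rewrite mule_ge0// lee_fin funrpos_ge0.
- exact: emeasurable_funM.
- by move=> r _; rewrite mule_ge0// lee_fin funrneg_ge0.
- by apply: filterS hn0 => r /[apply] /= ->; rewrite mul0e.
Qed.

Lemma single_crossing_le_integral :
  (forall r s, (a < r)%R -> (r <= s)%R -> (0 <= h r)%R -> (0 <= h s)%R) ->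
  \int[mu]_(r in D) ((h^\-%R r)%:E * l r) <= \int[mu]_(r in D) ((h^\+%R r)%:E * l r).
Proof.
move=> crossing; pose A := [set r : R | (a < r)%R /\ (0 <= h r)%R].
have lbA : lbound A a by move=> r [/ltW].
have [A0|noA] := pselect (A !=set0); last first.
  apply: le_integral_funrnegM_no_crossing => r ar; rewrite leNgt.
  by apply/negP => /ltW hr; apply: noA; exists r.
apply: (@le_integral_funrnegM_crossing (inf A)).
- exact: lb_le_inf.
- move=> r /andP[ar rA]; rewrite leNgt; apply/negP => /ltW hr.
  by move: rA; rewrite ltNge => /negP; apply; apply: ge_inf => //; exists a.
- move=> r rA; have [s [as_ hs] sr] := inf_lt A0 rA.
  exact: crossing as_ (ltW sr) hs.
Qed.

End single_crossing.

(** * Product Gaussian laws *)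

Section normal_density.
Context {R : realType}.
Local Notation mu := (@lebesgue_measure R).
Local Open Scope ereal_scope.

Lemma ge0_integral_normal_prob (m s : R) (f : R -> \bar R) :
  measurable_fun [set: R] f -> (forall x, 0 <= f x) ->
  \int[normal_prob m s]_x f x = \int[mu]_x (f x * (normal_pdf m s x)%:E).
Proof.
move=> mf f0; have dom := normal_prob_dominates m s.
rewrite -(Radon_Nikodym_SigmaFinite.change_of_variables dom)//.
have mpdf : measurable_fun setT (EFin \o normal_pdf m s).
  by apply/measurable_EFinP; exact: measurable_normal_pdf.
have irn := Radon_Nikodym_SigmaFinite.f_integrable dom.
apply: ae_eq_integral => //.
- by apply: emeasurable_funM => //; exact: measurable_int irn.
- exact: emeasurable_funM.
have : ae_eq mu setT (Radon_Nikodym_SigmaFinite.f (normal_prob m s) mu)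
    (EFin \o normal_pdf m s).
  by apply: integral_ae_eq => // E _ mE; rewrite -Radon_Nikodym_SigmaFinite.f_integral.
by apply: filterS => x /[apply] /= ->.
Qed.

Lemma normal_pdf1E (m x : R) :
  normal_pdf m 1 x = (normal_peak 1 * expR (- (x - m) ^+ 2 / 2))%R.
Proof. by rewrite normal_pdfE ?oner_eq0// /normal_fun expr1n. Qed.

End normal_density.

Section gauss_law.
Context {R : realType}.
Implicit Types (th v : nat -> R) (f : (nat -> R) -> \bar R).

Lemma measurable_upd d (T : measurableType d) (X : T -> nat -> R) n (x : T -> R) :
  measurable_fun setT X -> measurable_fun setT x ->
  measurable_fun setT (fun t => upd (X t) n (x t)).
Proof.
move=> /measurable_familyP mX mx; apply/measurable_familyP => i.
by rewrite /upd; case: (i == n).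
Qed.

Definition upd_pair n (z : (nat -> R) * measurableTypeR R) : nat -> R := upd z.1 n z.2.

HB.instance Definition _ n := isMeasurableFun.Build _ _ _ _ (upd_pair n)
  (measurable_upd n measurable_fst measurable_snd).

(* The law of a sequence with independent N(th j, 1) entries for j < n, and zero
   entries afterwards. *)
Fixpoint gauss_law th n : probability (nat -> R) R :=
  if n is n'.+1
  then distribution (gauss_law th n' \x normal_prob (th n') 1)%E (upd_pair n')
  else \d_((fun=> 0) : nat -> R).

Local Open Scope ereal_scope.

Lemma integral_gauss_lawS th n f : measurable_fun setT f -> (forall v, 0 <= f v) ->
  \int[gauss_law th n.+1]_v f v =
  \int[normal_prob (th n) 1]_x \int[gauss_law th n]_v f (upd v n x).
Proof.
move=> mf f0; rewrite ge0_integral_distribution// fubini_tonelli2//.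
  exact: measurableT_comp.
by move=> z; exact: f0.
Qed.

Lemma iter_gaussE th n f : measurable_fun setT f -> (forall v, 0 <= f v) ->
  iter_gauss th n f = \int[gauss_law th n]_v f v.
Proof.
elim: n f => [|n IH] f mf f0; first by rewrite integral_dirac//= diracT mul1e.
rewrite integral_gauss_lawS//=; apply: eq_integral => x _; apply: IH => //.
by apply: (measurableT_comp mf); exact: measurable_upd.
Qed.

End gauss_law.

Section squared_norm.
Context {R : realType}.
Implicit Types (n : nat) (r : R) (v w : nat -> R).

Definition dot n v w : R := \sum_(i < n) v i * w i.
Definition sqn n v : R := \sum_(i < n) v i ^+ 2.

Lemma sqn_ge0 n v : 0 <= sqn n v.
Proof. by apply: sumr_ge0 => i _; exact: sqr_ge0. Qed.

Lemma sqn0 n : sqn n (fun=> 0 : R) = 0.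
Proof. by rewrite /sqn big1// => i _; rewrite expr0n. Qed.

Lemma sqnZ n r v : sqn n (r \*o v) = r ^+ 2 * sqn n v.
Proof. by rewrite /sqn mulr_sumr; apply: eq_bigr => i _; rewrite exprMn. Qed.

Lemma sqnZB n r v w :
  sqn n (r \*o v \- w) = r ^+ 2 * sqn n v - 2 * r * dot n v w + sqn n w.
Proof.
by rewrite /sqn /dot !mulr_sumr -sumrB -big_split/=; apply: eq_bigr => i _; ring.
Qed.

Lemma sqn_upd n v x : sqn n.+1 (upd v n x) = sqn n v + x ^+ 2.
Proof.
rewrite /sqn big_ord_recr/= /upd eqxx; congr (_ + _); apply: eq_bigr => i _.
by rewrite ltn_eqF.
Qed.

Lemma dotNl n v w : dot n (\- v) w = - dot n v w.
Proof. by rewrite /dot -sumrN; apply: eq_bigr => i _; rewrite /= mulNr. Qed.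

Lemma dot0r n v : dot n v (fun=> 0) = 0.
Proof. by rewrite /dot big1// => i _; rewrite mulr0. Qed.

Lemma sqr_dot_le n v w : sqn n v = 1 -> dot n v w ^+ 2 <= sqn n w.
Proof.
move=> v1; have := sqn_ge0 n (dot n v w \*o v \- w).
by rewrite sqnZB v1 !expr2; lra.
Qed.

Section measurability.
Context d (T : measurableType d) (X : T -> nat -> R).
Hypothesis mX : measurable_fun setT X.

Lemma measurable_coord i : measurable_fun setT (fun t => X t i).
Proof. by move/measurable_familyP: mX. Qed.

Lemma measurable_sqn n : measurable_fun setT (fun t => sqn n (X t)).
Proof.
by apply: measurable_sum => i; apply: measurable_funX; exact: measurable_coord.
Qed.

Lemma measurable_dotl n w : measurable_fun setT (fun t => dot n (X t) w).
Proof.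
by apply: measurable_sum => i; apply: measurable_funM => //; exact: measurable_coord.
Qed.

Lemma measurable_scale (r : T -> R) : measurable_fun setT r ->
  measurable_fun setT (fun t => r t \*o X t).
Proof.
move=> mr; apply/measurable_familyP => i; apply: measurable_funM => //.
exact: measurable_coord.
Qed.

Lemma measurable_translate w : measurable_fun setT (fun t => X t \- w).
Proof.
by apply/measurable_familyP => i; apply: measurable_funB => //; exact: measurable_coord.
Qed.

End measurability.
End squared_norm.

Section gauss_dilation.
Context {R : realType}.
Implicit Types (m r : R) (th v : nat -> R).

(* Density, with respect to the standard Gaussian law, of the law of X / r where
   X has law [gauss_law th n]. *)
Definition dilation_density n th r v : R :=
  `|r| ^+ n * expR ((sqn n v - sqn n (r \*o v \- th)) / 2).

Lemma dilation_density_ge0 n th r v : 0 <= dilation_density n th r v.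
Proof. by rewrite mulr_ge0 ?exprn_ge0 ?expR_ge0. Qed.

Lemma measurable_dilation_density n th r :
  measurable_fun setT (dilation_density n th r).
Proof.
apply: measurable_funM => //; apply: measurable_fun_expR; apply: measurable_funM => //.
apply: measurable_funB; first exact: (measurable_sqn (X := id)).
apply: (measurable_sqn (X := fun v => r \*o v \- th)).
apply: (measurable_translate (X := fun v => r \*o v)).
exact: (measurable_scale (X := id)).
Qed.

Lemma dilation_densityS n th r v x :
  dilation_density n.+1 th r (upd v n x) =
  `|r| * expR ((x ^+ 2 - (r * x - th n) ^+ 2) / 2) * dilation_density n th r v.
Proof.
rewrite /dilation_density.
have -> : r \*o upd v n x \- th = upd (r \*o v \- th) n (r * x - th n).
  by apply/funext => j; rewrite /upd/=; case: eqP => // ->.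
rewrite !sqn_upd mulrACA -exprS -expRD; congr (_ * expR _); ring.
Qed.

Local Open Scope ereal_scope.

Lemma integral_normal_prob_dilation m r (f : R -> \bar R) : r != 0%R ->
  measurable_fun [set: R] f -> (forall x, 0 <= f x) ->
  \int[normal_prob m 1]_x f x = \int[normal_prob 0%R 1]_x
    ((`|r| * expR ((x ^+ 2 - (r * x - m) ^+ 2) / 2))%:E * f (r * x)%R).
Proof.
move=> r0 mf f0.
have mr : measurable_fun [set: R] ( *%R r) by exact: measurable_funM.
have mpdf (s : R) : measurable_fun [set: R] (EFin \o normal_pdf s 1).
  by apply/measurable_EFinP; exact: measurable_normal_pdf.
have mfr : measurable_fun [set: R] (fun x => f (r * x)%R) by exact: (measurableT_comp mf).
rewrite (ge0_integral_normal_prob m)// (ge0_integral_normal_prob 0%R); last 2 first.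
- apply: emeasurable_funM => //; apply/measurable_EFinP; apply: measurable_funM => //.
  apply: measurable_fun_expR; apply: measurable_funM => //; apply: measurable_funB => //.
  by apply: measurable_funX; exact: measurable_funB.
- by move=> x; rewrite mule_ge0// lee_fin mulr_ge0 ?expR_ge0.
rewrite (ge0_integral_dilation r0)//; last 2 first.
- by apply: emeasurable_funM => //; exact: mpdf.
- by move=> x; rewrite mule_ge0// lee_fin normal_pdf_ge0.
rewrite -ge0_integralZl//; last 2 first.
- apply: emeasurable_funM => //; exact: (measurableT_comp (mpdf m) mr).
- by move=> x; rewrite mule_ge0// lee_fin normal_pdf_ge0.
apply: eq_integral => x _.
rewrite muleCA [in RHS]muleAC -[in RHS]EFinM -EFinM muleC; congr (_%:E * _).
rewrite !normal_pdf1E subr0 mulrA [in RHS]mulrACA -expRD.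
by congr (_ * expR _)%R; ring.
Qed.

Lemma integral_gauss_law_dilation th r n (f : (nat -> R) -> \bar R) : r != 0%R ->
  measurable_fun setT f -> (forall v, 0 <= f v) ->
  \int[gauss_law th n]_v f v = \int[gauss_law (fun=> 0%R) n]_v
    ((dilation_density n th r v)%:E * f (r \*o v)).
Proof.
move=> r0.
have mdil k (g : (nat -> R) -> \bar R) : measurable_fun setT g ->
    measurable_fun setT (fun v => (dilation_density k th r v)%:E * g (r \*o v)).
  move=> mg; apply: emeasurable_funM.
    by apply/measurable_EFinP; exact: measurable_dilation_density.
  by apply: (measurableT_comp mg); exact: (measurable_scale (X := id)).
have dil_ge0 k (g : (nat -> R) -> \bar R) v : (forall v, 0 <= g v) ->
    0 <= (dilation_density k th r v)%:E * g (r \*o v).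
  by move=> g0; rewrite mule_ge0// lee_fin dilation_density_ge0.
elim: n f => [|n IH] f mf f0.
  rewrite /= !integral_dirac//; last exact: mdil.
  rewrite /dilation_density /sqn !big_ord0 expr0 subrr mul0r expR0 mul1r mul1e.
  by congr (_ * f _); apply/funext => j; rewrite /= mulr0.
rewrite (integral_gauss_lawS th)// (integral_gauss_lawS (fun=> 0%R)); last 2 first.
- exact: mdil.
- by move=> v; exact: dil_ge0.
rewrite (integral_normal_prob_dilation _ r0); last 2 first.
- apply: (measurable_fun_fubini_tonelli_F (m2 := gauss_law th n)
    (fun z : measurableTypeR R * (nat -> R) => f (upd z.2 n z.1))) => //.
  by apply: (measurableT_comp mf); exact: measurable_upd.
- by move=> x; exact: integral_ge0.
apply: eq_integral => x _.
have mfx y : measurable_fun setT (fun v => f (upd v n y)).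
  by apply: (measurableT_comp mf); exact: measurable_upd.
rewrite IH// -ge0_integralZl//; last 2 first.
- exact: (mdil n _ (mfx (r * x)%R)).
- by move=> v _; apply: (dil_ge0 n (fun v => f (upd v n (r * x)%R))).
apply: eq_integral => v _; rewrite dilation_densityS EFinM muleA; congr (_ * f _).
by apply/funext => j; rewrite /upd/=; case: eqP.
Qed.

End gauss_dilation.

(** * Polar coordinates *)

Section sphere_law.
Context {R : realType}.
Implicit Types (p : nat) (th v s : nat -> R) (f g : (nat -> R) -> \bar R).

Definition direction p v : nat -> R := (Num.sqrt (sqn p v))^-1 \*o v.

Lemma directionN p v : direction p (\- v) = \- direction p v.
Proof.
apply/funext => j; rewrite /direction/= mulrN; congr (- (_^-1 * _)).
by congr Num.sqrt; apply: eq_bigr => i _; rewrite /= sqrrN.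
Qed.

Lemma sqn_direction p v : 0 < sqn p v -> sqn p (direction p v) = 1.
Proof.
by move=> v0; rewrite sqnZ exprVn sqr_sqrtr ?mulVf ?gt_eqF// ltW.
Qed.

Lemma measurable_direction p : measurable_fun setT (direction p).
Proof.
apply: (measurable_scale (X := id)) => //; apply: measurable_funV.
by apply: measurable_fun_sqrt; exact: (measurable_sqn (X := id)).
Qed.

HB.instance Definition _ p :=
  isMeasurableFun.Build _ _ _ _ (direction p) (measurable_direction p).

Definition sphere_law p : probability (nat -> R) R :=
  distribution (gauss_law (fun=> 0) p) (direction p).

Lemma gauss_law_sqn_gt0 th p : (0 < p)%N -> {ae gauss_law th p, forall v, 0 < sqn p v}.
Proof.
case: p => // p _; exists [set v : nat -> R | v p = 0]; split.
- rewrite -[X in measurable X]setTI.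
  exact: (measurable_proj p measurableT (measurable_set1 0)).
- rewrite /= /distribution /pushforward/=.
  have -> : upd_pair p @^-1` [set v : nat -> R | v p = 0] = setT `*` [set 0].
    by apply/seteqP; split => -[v x]/=; rewrite /upd_pair/= /upd eqxx//= => -[].
  by rewrite product_measure1E// [X in (_ * X)%E]integral_set1 mule0.
- move=> v/=; apply: contra_notP => /eqP vp.
  rewrite /sqn big_ord_recr/= ltr_wpDl ?exprn_even_gt0//.
  by apply: sumr_ge0 => i _; exact: sqr_ge0.
Qed.

Lemma sphere_law_unit p : (0 < p)%N -> {ae sphere_law p, forall s, sqn p s = 1}.
Proof.
move=> p0; have mU : measurable (sqn p @^-1` [set 1 : R]).
  rewrite -[X in measurable X]setTI.
  by apply: (measurable_sqn (X := id)) => //; exact: measurable_set1.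
exists (~` (sqn p @^-1` [set 1])); split => //; first exact: measurableC.
rewrite /= /distribution /pushforward; apply/negligibleP.
  exact: (measurable_funPTI (direction p) (measurableC mU)).
apply: negligibleS (gauss_law_sqn_gt0 (fun=> 0) p0) => v /=.
by apply: contra_not; exact: sqn_direction.
Qed.

Local Open Scope ereal_scope.

Lemma integral_sphere_law p f : measurable_fun setT f -> (forall s, 0 <= f s) ->
  \int[sphere_law p]_s f s = \int[gauss_law (fun=> 0%R) p]_v f (direction p v).
Proof. exact: ge0_integral_distribution. Qed.

Lemma ge0_eq_integral_sphere_law p f g : (0 < p)%N ->
  measurable_fun setT f -> measurable_fun setT g ->
  (forall s, 0 <= f s) -> (forall s, 0 <= g s) ->
  (forall s, sqn p s = 1%R -> f s = g s) ->
  \int[sphere_law p]_s f s = \int[sphere_law p]_s g s.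
Proof.
move=> p0 mf mg f0 g0 fg; apply: ge0_ae_eq_integral => //.
by apply: filterS (sphere_law_unit p0) => s s1 _; exact: fg.
Qed.

Lemma ge0_le_integral_sphere_law p f g : (0 < p)%N ->
  measurable_fun setT f -> measurable_fun setT g ->
  (forall s, 0 <= f s) -> (forall s, 0 <= g s) ->
  (forall s, sqn p s = 1%R -> f s <= g s) ->
  \int[sphere_law p]_s f s <= \int[sphere_law p]_s g s.
Proof.
move=> p0 mf mg f0 g0 fg; apply: ae_ge0_le_integral => //.
by apply: filterS (sphere_law_unit p0) => s s1 _; exact: fg.
Qed.

Lemma measurable_oppf : measurable_fun setT (fun v : nat -> R => \- v)%R.
Proof.
by apply/measurable_familyP => i; apply: measurable_funN; exact: measurable_proj.
Qed.

Lemma integral_sphere_lawN p f : measurable_fun setT f -> (forall s, 0 <= f s) ->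
  \int[sphere_law p]_s f (\- s)%R = \int[sphere_law p]_s f s.
Proof.
have N1 : (-1)%R != 0%R :> R by rewrite oppr_eq0 oner_eq0.
move=> mf f0; rewrite !integral_sphere_law//; last first.
  exact: (measurableT_comp mf measurable_oppf).
rewrite [RHS](integral_gauss_law_dilation _ _ N1)//; last first.
  exact: (measurableT_comp mf (measurable_direction p)).
apply: eq_integral => v _; rewrite -directionN.
have -> : (\- v = -1 \*o v)%R by apply/funext => j; rewrite /= mulN1r.
rewrite /dilation_density normrN1 expr1n mul1r.
have -> : (-1 \*o v \- (fun=> 0) = -1 \*o v)%R by apply/funext => j; rewrite /= subr0.
by rewrite sqnZ sqrrN expr1n mul1r subrr mul0r expR0 mul1e.
Qed.

Lemma integral_sphere_law_symmetrize p f :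
  measurable_fun setT f -> (forall s, 0 <= f s) ->
  \int[sphere_law p]_s f s =
  (2^-1)%:E * \int[sphere_law p]_s (f s + f (\- s)%R).
Proof.
move=> mf f0; rewrite ge0_integralD//; last exact: (measurableT_comp mf measurable_oppf).
by rewrite integral_sphere_lawN// -mule2n -mule_natl muleA -EFinM mulVf ?mul1e//.
Qed.

End sphere_law.

Section polar_coordinates.
Context {R : realType}.
Local Notation mu := (@lebesgue_measure R).
Implicit Types (p : nat) (r c : R) (th v s : nat -> R) (f : (nat -> R) -> \bar R).

Definition polar_density p th v r : R :=
  r ^+ p.-1 * expR (- sqn p (r \*o v \- th) / 2).

(* Invariant under joint dilation of r and c, up to the density of dr / r. *)
Definition polar_kernel p c r : R :=
  (c / r) ^+ p * expR (- (c / r) ^+ 2 / 2) / r.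

Lemma polar_density_ge0 p th v r : 0 < r -> 0 <= polar_density p th v r.
Proof. by move=> r0; rewrite mulr_ge0 ?expR_ge0// exprn_ge0// ltW. Qed.

Lemma polar_kernel_ge0 p c r : 0 <= c -> 0 < r -> 0 <= polar_kernel p c r.
Proof. by move=> c0 r0; rewrite divr_ge0 ?mulr_ge0 ?expR_ge0 ?exprn_ge0 ?divr_ge0// ltW. Qed.

Lemma measurable_polar_density p th d (T : measurableType d) (X : T -> nat -> R)
    (r : T -> R) : measurable_fun setT X -> measurable_fun setT r ->
  measurable_fun setT (fun t => polar_density p th (X t) (r t)).
Proof.
move=> mX mr; apply: measurable_funM; first exact: measurable_funX.
apply: measurable_fun_expR; apply: measurable_funM => //; apply: measurable_funN.
by apply: measurable_sqn; apply: measurable_translate; exact: measurable_scale.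
Qed.

Lemma measurable_polar_kernel p d (T : measurableType d) (c r : T -> R) :
  measurable_fun setT c -> measurable_fun setT r ->
  measurable_fun setT (fun t => polar_kernel p (c t) (r t)).
Proof.
move=> mc mr; have mV : measurable_fun setT (fun t => (r t)^-1) by exact: measurable_funV.
have mcV : measurable_fun setT (fun t => c t / r t) by exact: measurable_funM.
apply: measurable_funM => //; apply: measurable_funM; first exact: measurable_funX.
apply: measurable_fun_expR; apply: measurable_funM => //; apply: measurable_funN.
exact: measurable_funX.
Qed.

Lemma dilation_polar_kernel p th v r : (0 < p)%N -> 0 < r ->
  dilation_density p th r v * polar_kernel p (Num.sqrt (sqn p (r \*o v))) r =
  Num.sqrt (sqn p v) ^+ p * polar_density p th v r.
Proof.
move=> p0 r0; rewrite /dilation_density /polar_kernel /polar_density.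
rewrite sqnZ sqrtrM ?sqr_ge0// sqrtr_sqr gtr0_norm// [r * _]mulrC mulfK ?gt_eqF//.
rewrite sqr_sqrtr ?sqn_ge0// [(_ - _) / 2]mulrBl expRD !mulNr !expRN.
have -> : r ^+ p = r * r ^+ p.-1 by rewrite -exprS prednK.
by field; rewrite !gt_eqF ?expR_gt0.
Qed.

Local Open Scope ereal_scope.

Lemma integral_polar_kernel p c : (0 < c)%R ->
  \int[mu]_(r in half_line R) (polar_kernel p c r)%:E =
  \int[mu]_(r in half_line R) (polar_kernel p 1 r)%:E.
Proof.
move=> c0.
have mkernel b : measurable_fun (half_line R) (EFin \o polar_kernel p b).
  by apply/measurable_EFinP/measurable_funTS; exact: measurable_polar_kernel.
rewrite (ge0_integral0y_dilation c0); last 2 first.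
- exact: mkernel.
- by move=> r r0; rewrite lee_fin polar_kernel_ge0// ltW.
rewrite -ge0_integralZl//; last 3 first.
- apply/measurable_EFinP/measurable_funTS.
  by apply: measurable_polar_kernel => //; exact: measurable_funM.
- by move=> r; rewrite half_lineE => r0; rewrite lee_fin polar_kernel_ge0 ?ltW// mulr_gt0.
- by rewrite lee_fin ltW.
apply: eq_integral => r; rewrite mem_half_line => r0; rewrite -EFinM; congr EFin.
rewrite /polar_kernel; have -> : (c / (c * r) = 1 / r)%R by field; rewrite !gt_eqF.
by field; rewrite !gt_eqF.
Qed.

Lemma integral_polar_direction p th v f : (0 < p)%N -> (0 < sqn p v)%R ->
  measurable_fun setT f -> (forall v, 0 <= f v) ->
  \int[mu]_(r in half_line R)
    ((Num.sqrt (sqn p v) ^+ p * polar_density p th v r)%:E * f (r \*o v)) =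
  \int[mu]_(r in half_line R)
    ((polar_density p th (direction p v) r)%:E * f (r \*o direction p v)).
Proof.
move=> p0 v0 mf f0; set c := Num.sqrt (sqn p v).
have c0 : (0 < c)%R by rewrite sqrtr_gt0.
have cK r : (c * r)%R \*o direction p v = r \*o v.
  by apply/funext => j; rewrite /direction/= -/c; field; rewrite gt_eqF.
have mF w : measurable_fun setT (fun r : R => (polar_density p th w r)%:E * f (r \*o w)).
  apply: emeasurable_funM.
    by apply/measurable_EFinP; exact: (measurable_polar_density _ _ (X := fun=> w)).
  by apply: (measurableT_comp mf); exact: (measurable_scale (X := fun=> w)).
rewrite [RHS](ge0_integral0y_dilation c0); last 2 first.
- exact: measurable_funTS.
- by move=> r r0; rewrite mule_ge0// lee_fin polar_density_ge0.
rewrite -ge0_integralZl//; last 3 first.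
- apply: measurable_funTS.
  apply: (measurableT_comp (mF (direction p v))) => //; exact: measurable_funM.
- move=> r; rewrite half_lineE => r0.
  by rewrite mule_ge0// lee_fin polar_density_ge0// mulr_gt0.
- by rewrite lee_fin ltW.
apply: eq_integral => r _; rewrite cK muleA -EFinM; congr (_%:E * _).
rewrite /polar_density cK exprMn !mulrA -exprS prednK//.
Qed.

Definition ray_integral p th f s : \bar R :=
  \int[mu]_(r in half_line R) ((polar_density p th s r)%:E * f (r \*o s)).

Lemma measurable_ray_integrand p th f : measurable_fun setT f ->
  measurable_fun setT (fun z : (nat -> R) * measurableTypeR R =>
    (polar_density p th z.1 z.2)%:E * f (z.2 \*o z.1)).
Proof.
move=> mf; apply: emeasurable_funM.
  apply/measurable_EFinP.
  exact: measurable_polar_density measurable_fst measurable_snd.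
by apply: (measurableT_comp mf); exact: measurable_scale measurable_fst _ measurable_snd.
Qed.

Lemma ray_integral_ge0 p th f s : (forall v, 0 <= f v) -> 0 <= ray_integral p th f s.
Proof.
move=> f0; apply: integral_ge0 => r; rewrite half_lineE => r0.
by rewrite mule_ge0// lee_fin polar_density_ge0.
Qed.

Lemma measurable_ray_integral p th f : measurable_fun setT f -> (forall v, 0 <= f v) ->
  measurable_fun setT (ray_integral p th f).
Proof.
move=> mf f0; apply: (measurable_fun_integral_in mu _
  (measurable_ray_integrand p th mf)) => // s r.
by rewrite half_lineE => r0; rewrite mule_ge0// lee_fin polar_density_ge0.
Qed.

Definition polar_mass p := \int[mu]_(r in half_line R) (polar_kernel p 1 r)%:E.

Definition kernel_integrand p f (z : (nat -> R) * measurableTypeR R) :=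
  (polar_kernel p (Num.sqrt (sqn p z.1)) z.2)%:E * f z.1.

Definition dilated_integrand p th f (z : (nat -> R) * measurableTypeR R) :=
  (Num.sqrt (sqn p z.1) ^+ p * polar_density p th z.1 z.2)%:E * f (z.2 \*o z.1).

Let measurable_norm p : measurable_fun setT
  (fun z : (nat -> R) * measurableTypeR R => Num.sqrt (sqn p z.1)).
Proof. by apply: measurable_fun_sqrt; exact: measurable_sqn measurable_fst _. Qed.

Section measurable_integrand.
Variables (p : nat) (f : (nat -> R) -> \bar R).
Hypotheses (mf : measurable_fun setT f) (f0 : forall v, 0 <= f v).

Let measurable_kernel_integrand : measurable_fun setT (kernel_integrand p f).
Proof.
apply: emeasurable_funM; last exact: (measurableT_comp mf measurable_fst).
by apply/measurable_EFinP; exact: measurable_polar_kernel.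
Qed.

Let measurable_dilated_integrand th : measurable_fun setT (dilated_integrand p th f).
Proof.
apply: emeasurable_funM.
  apply/measurable_EFinP; apply: measurable_funM; first exact: measurable_funX.
  exact: measurable_polar_density measurable_fst measurable_snd.
by apply: (measurableT_comp mf); exact: measurable_scale measurable_fst _ measurable_snd.
Qed.

Let kernel_integrand_ge0 v r : half_line R r -> 0 <= kernel_integrand p f (v, r).
Proof. by rewrite half_lineE => r0; rewrite mule_ge0// lee_fin polar_kernel_ge0. Qed.

Let dilated_integrand_ge0 th v r : half_line R r -> 0 <= dilated_integrand p th f (v, r).
Proof.
rewrite half_lineE => r0.
by rewrite mule_ge0// lee_fin mulr_ge0 ?exprn_ge0 ?polar_density_ge0.
Qed.

Lemma integral_kernel_integrand th : (0 < p)%N ->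
  \int[gauss_law th p]_v \int[mu]_(r in half_line R) kernel_integrand p f (v, r) =
  polar_mass p * \int[gauss_law th p]_v f v.
Proof.
move=> p0; have mass_ge0 : 0 <= polar_mass p.
  by apply: integral_ge0 => r; rewrite half_lineE => r0; rewrite lee_fin polar_kernel_ge0.
rewrite -ge0_integralZl//; apply: ge0_ae_eq_integral => //.
- exact: (measurable_fun_integral_in mu _ measurable_kernel_integrand).
- exact: measurable_funeM.
- by move=> v _; apply: integral_ge0; exact: kernel_integrand_ge0.
- by move=> v _; rewrite mule_ge0.
apply: filterS (gauss_law_sqn_gt0 th p0) => v v0 _.
rewrite /kernel_integrand/= ge0_integralZr ?integral_polar_kernel ?sqrtr_gt0//.
  by apply/measurable_EFinP/measurable_funTS; exact: measurable_polar_kernel.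
by move=> r; rewrite half_lineE => r0; rewrite lee_fin polar_kernel_ge0.
Qed.

Lemma integral_dilated_integrand th r : (0 < p)%N -> (0 < r)%R ->
  \int[gauss_law th p]_v kernel_integrand p f (v, r) =
  \int[gauss_law (fun=> 0%R) p]_v dilated_integrand p th f (v, r).
Proof.
move=> p0 r0; rewrite [LHS](@integral_gauss_law_dilation _ _ r); last 3 first.
- by rewrite gt_eqF.
- exact: (measurableT_comp measurable_kernel_integrand (measurable_pair2 r)).
- by move=> v; apply: kernel_integrand_ge0; rewrite half_lineE.
apply: eq_integral => v _; rewrite /kernel_integrand/= muleA -EFinM.
by rewrite dilation_polar_kernel.
Qed.

(* Polar coordinates without a surface measure: insert the kernel, integrate over
   the dilation parameter and rescale the Gaussian. *)
Lemma polar_formula th : (0 < p)%N ->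
  polar_mass p * \int[gauss_law th p]_v f v =
  \int[sphere_law p]_s ray_integral p th f s.
Proof.
move=> p0; rewrite -integral_kernel_integrand//.
rewrite (fubini_tonelli_in (gauss_law th p) mu _ measurable_kernel_integrand)//.
under eq_integral => r rD.
  rewrite integral_dilated_integrand//; last by rewrite -mem_half_line.
  over.
rewrite -(fubini_tonelli_in (gauss_law (fun=> 0%R) p) mu _
  (measurable_dilated_integrand th))//; last exact: dilated_integrand_ge0.
have mray := measurable_ray_integral p th mf f0.
rewrite integral_sphere_law; last 2 first.
- exact: mray.
- by move=> s; exact: ray_integral_ge0.
apply: ge0_ae_eq_integral.
- exact: measurableT.
- exact: (measurable_fun_integral_in mu _ (measurable_dilated_integrand th)
    (dilated_integrand_ge0 th)).
- exact: (measurableT_comp mray (measurable_direction p)).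
- by move=> v _; apply: integral_ge0; exact: dilated_integrand_ge0.
- by move=> v _; exact: ray_integral_ge0.
apply: filterS (gauss_law_sqn_gt0 (fun=> 0%R) p0) => v v0 _.
exact: integral_polar_direction.
Qed.

End measurable_integrand.

Lemma polar_mass_gt0_lty p : (0 < p)%N -> 0 < polar_mass p < +oo.
Proof.
(* f is chosen so that its integral along every ray from the origin is 1. *)
move=> p0; pose f (v : nat -> R) := ((Num.sqrt (sqn p v))^-1 ^+ p.-1 *
  expR (sqn p v / 2 - Num.sqrt (sqn p v)))%:E.
have f0 v : 0 <= f v by rewrite lee_fin mulr_ge0 ?expR_ge0 ?exprn_ge0 ?invr_ge0.
have mf : measurable_fun setT f.
  have mq : measurable_fun setT (fun v : nat -> R => sqn p v).
    exact: (measurable_sqn (X := id)).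
  have msqrt := measurable_fun_sqrt mq.
  apply/measurable_EFinP; apply: measurable_funM.
    by apply: measurable_funX; exact: measurable_funV.
  by apply: measurable_fun_expR; apply: measurable_funB => //; exact: measurable_funM.
have ray1 s : sqn p s = 1%R -> ray_integral p (fun=> 0%R) f s = 1.
  move=> s1; rewrite -integral_expRN; apply: eq_integral => r.
  rewrite mem_half_line => r0; rewrite /f -EFinM; congr EFin.
  rewrite /polar_density sqnZB sqn0 dot0r !sqnZ s1 !mulr1 mulr0 subr0 addr0.
  rewrite sqrtr_sqr gtr0_norm// mulrACA exprVn divff ?expf_neq0 ?gt_eqF// mul1r.
  by rewrite -expRD; congr expR; field.
have : polar_mass p * \int[gauss_law (fun=> 0%R) p]_v f v = 1.
  rewrite polar_formula//.
  rewrite -[RHS](integral_probability_cst (sphere_law p)).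
  apply: ge0_eq_integral_sphere_law => //; first exact: measurable_ray_integral.
  by move=> s; exact: ray_integral_ge0.
apply: mule_eq1_gt0_lty; last exact: integral_ge0.
apply: integral_ge0 => r; rewrite half_lineE => r0.
by rewrite lee_fin polar_kernel_ge0.
Qed.

Lemma polar_coordinates p : (0 < p)%N -> exists2 C : R, (0 < C)%R &
  forall th f, measurable_fun setT f -> (forall v, 0 <= f v) ->
    C%:E * \int[gauss_law th p]_v f v = \int[sphere_law p]_s ray_integral p th f s.
Proof.
move=> p0; have mass := polar_mass_gt0_lty p0.
exists (fine (polar_mass p)); first exact: fine_gt0.
move=> th f mf f0; rewrite fineK ?polar_formula//.
by case/andP: mass => mass_gt0; rewrite ge0_fin_numE// ltW.
Qed.

End polar_coordinates.

(** * Risk along a ray *)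

(* Along the ray r s, with s a unit vector of inner product a with the mean, b the
   squared norm of the mean, and y the shrinkage at r ^+ 2. *)
Section ray.
Context {R : realType}.
Implicit Types (a b r : R) (y g : R -> R).

Definition ray_gauss a b r : R := expR (- (r ^+ 2 - 2 * r * a + b) / 2).

Definition ray_loss (y a b r : R) : R :=
  ((1 - y / r ^+ 2) * r) ^+ 2 - 2 * ((1 - y / r ^+ 2) * r) * a + b.

Definition ray_risk n y g a b r : R :=
  r ^+ n * ray_gauss a b r * (ray_loss (y (r ^+ 2)) a b r + g (r ^+ 2)).

Lemma is_derive_ray_gauss a b r :
  is_derive r 1 (ray_gauss a b) (ray_gauss a b r * (a - r)).
Proof.
have dpoly : is_derive r 1 (fun x : R => - (x ^+ 2 - 2 * x * a + b) / 2) (a - r).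
  by apply: is_derive_eq; rewrite /GRing.scale/=; field.
exact: (is_derive1_comp (f := expR)).
Qed.

Lemma ray_loss_ge0 (y a b r : R) : a ^+ 2 <= b -> 0 <= ray_loss y a b r.
Proof.
move=> ab; rewrite /ray_loss; set t := _ * r.
have -> : t ^+ 2 - 2 * t * a + b = (t - a) ^+ 2 + (b - a ^+ 2) by ring.
by rewrite addr_ge0 ?sqr_ge0 ?subr_ge0.
Qed.

Lemma ray_risk_ge0 n y g a b r : a ^+ 2 <= b -> 0 < r -> 0 <= g (r ^+ 2) ->
  0 <= ray_risk n y g a b r.
Proof.
move=> ab r0 g0; apply: mulr_ge0; last by rewrite addr_ge0 ?ray_loss_ge0.
by rewrite mulr_ge0 ?expR_ge0// exprn_ge0// ltW.
Qed.

Lemma continuous_ray_risk n y g a b r : 0 < r ->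
  {for (r ^+ 2), continuous y} -> {for (r ^+ 2), continuous g} ->
  {for r, continuous (ray_risk n y g a b)}.
Proof.
move=> r0 cy cg.
have csq h : {for (r ^+ 2), continuous h} ->
    {for r, continuous (fun x : R => h (x ^+ 2) : R)}.
  by move=> ch; exact: (cvg_comp _ _ (@exprn_continuous _ 2 r) ch).
have cshrink : {for r, continuous (fun x : R => (1 - y (x ^+ 2) / x ^+ 2) * x)}.
  apply: cvgM; last exact: cvg_id.
  apply: cvgB; first exact: cvg_cst.
  apply: cvgM; first exact: csq.
  by apply: cvgV; [rewrite expf_neq0// gt_eqF|exact: exprn_continuous].
apply: cvgM.
  apply: cvgM; first exact: exprn_continuous.
  exact: is_derive1_continuous (is_derive_ray_gauss a b r).
apply: cvgD; last exact: csq.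
apply: cvgD; last exact: cvg_cst.
apply: cvgB; first exact: (cvg_comp _ _ cshrink (@exprn_continuous _ 2 _)).
by apply: cvgM; [apply: cvgM => //; exact: cvg_cst|exact: cvg_cst].
Qed.

Lemma exprn_ray_gauss_le n a b r : 0 <= r -> a ^+ 2 <= b ->
  r ^+ n * ray_gauss a b r <= n`!%:R * expR (b + 3) * expR (- r).
Proof.
move=> r0 ab; apply: (le_trans (ler_wpM2r (expR_ge0 _) (exprn_le_fact_expR n r0))).
rewrite -!mulrA ler_wpM2l// -!expRD ler_expR.
have := sqr_ge0 (r - a - 2); have := sqr_ge0 (a - 1).
rewrite !expr2 in ab *; nra.
Qed.

Lemma exprn_ray_gauss_cvgy n a b : a ^+ 2 <= b ->
  r ^+ n * ray_gauss a b r @[r --> +oo] --> 0.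
Proof.
move=> ab; apply: (@squeeze_cvgr _ _ _ _ (fun=> 0)
  (fun r => n`!%:R * expR (b + 3) * expR (- r))).
- near=> r; have r0 : 0 < r by near: r; exact: nbhs_pinfty_gt.
  rewrite mulr_ge0 ?expR_ge0 ?exprn_ge0 ?(ltW r0)//=.
  by apply: exprn_ray_gauss_le => //; exact: ltW.
- exact: cvg_cst.
- rewrite -[X in _ --> X](mulr0 (n`!%:R * expR (b + 3))).
  by apply: cvgM; [exact: cvg_cst|exact: cvgr_expR].
Unshelve. all: by end_near. Qed.

Lemma exprnS_ray_gauss_cvg0 n a b :
  r ^+ n.+1 * ray_gauss a b r @[r --> 0^'+] --> 0.
Proof.
apply: cvg_at_right_filter.
have value0 : 0 ^+ n.+1 * ray_gauss a b 0 = 0 by rewrite expr0n mul0r.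
rewrite -[X in _ --> X]value0; apply: cvgM; first exact: exprn_continuous.
exact: is_derive1_continuous (is_derive_ray_gauss a b 0).
Qed.

End ray.

(** * Likelihood ratio of the radius *)

Section radial_likelihood.
Context {R : realType} (p : nat).
Hypothesis p0 : (0 < p)%N.
Local Notation mu := (@lebesgue_measure R).
Implicit Types (r : R) (s th v : nat -> R).

Lemma polar_density_unit th s r : sqn p s = 1 ->
  polar_density p th s r = r ^+ p.-1 * ray_gauss (dot p s th) (sqn p th) r.
Proof. by move=> s1; rewrite /polar_density sqnZB s1 mulr1. Qed.

Definition radial_density r : R := r ^+ p.-1 * expR (- r ^+ 2 / 2).

Definition direction_likelihood th s r : R := expR (r * dot p s th - sqn p th / 2).

Lemma ray_gauss_likelihood th s r :
  ray_gauss (dot p s th) (sqn p th) r = expR (- r ^+ 2 / 2) * direction_likelihood th s r.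
Proof. by rewrite -expRD; congr expR; field. Qed.

Lemma radial_density_gt0 r : 0 < r -> 0 < radial_density r.
Proof. by move=> r0; rewrite mulr_gt0 ?expR_gt0 ?exprn_gt0. Qed.

Lemma measurable_radial_density : measurable_fun [set: R] radial_density.
Proof.
apply: measurable_funM; first exact: measurable_funX.
apply: measurable_fun_expR; apply: measurable_funM => //.
by apply: measurable_funN; exact: measurable_funX.
Qed.

Lemma measurable_direction_likelihood d (T : measurableType d) th
    (X : T -> nat -> R) (r : T -> R) :
  measurable_fun setT X -> measurable_fun setT r ->
  measurable_fun setT (fun t => direction_likelihood th (X t) (r t)).
Proof.
move=> mX mr; apply: measurable_fun_expR; apply: measurable_funB => //.
by apply: measurable_funM => //; exact: measurable_dotl.
Qed.

Local Open Scope ereal_scope.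

(* With respect to its law under the standard Gaussian, the radius of a Gaussian
   vector of mean th has density radial_likelihood th. *)
Definition radial_likelihood th r : \bar R :=
  \int[sphere_law p]_s (direction_likelihood th s r)%:E.

Lemma radial_likelihood_ge0 th r : 0 <= radial_likelihood th r.
Proof. by apply: integral_ge0 => s _; rewrite lee_fin expR_ge0. Qed.

Lemma measurable_radial_likelihood th : measurable_fun [set: R] (radial_likelihood th).
Proof.
apply: (measurable_fun_fubini_tonelli_F (m2 := sphere_law p)
  (fun z : measurableTypeR R * (nat -> R) => (direction_likelihood th z.2 z.1)%:E)) => [|z].
  by apply/measurable_EFinP; exact: measurable_direction_likelihood.
by rewrite lee_fin expR_ge0.
Qed.

Lemma radial_likelihood0 r : radial_likelihood (fun=> 0%R) r = 1.
Proof.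
rewrite -[RHS](integral_probability_cst (sphere_law p)).
apply: eq_integral => s _; congr EFin.
by rewrite /direction_likelihood dot0r sqn0 mulr0 mul0r subrr expR0.
Qed.

Lemma radial_likelihood_nondecreasing th r1 r2 : (0 <= r1)%R -> (r1 <= r2)%R ->
  radial_likelihood th r1 <= radial_likelihood th r2.
Proof.
move=> r10 r12; have mlik r : measurable_fun setT (fun s => (direction_likelihood th s r)%:E).
  apply/measurable_EFinP.
  exact: (measurable_direction_likelihood _ (X := id) (r := fun=> r)).
have mlikN r : measurable_fun setT (fun s => (direction_likelihood th (\- s)%R r)%:E).
  exact: (measurableT_comp (mlik r) measurable_oppf).
have lik0 s r : 0 <= (direction_likelihood th s r)%:E by rewrite lee_fin expR_ge0.
rewrite /radial_likelihood.
rewrite !(integral_sphere_law_symmetrize _ (mlik _) (lik0^~ _)).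
apply: lee_wpmul2l; first by rewrite lee_fin invr_ge0.
apply: ge0_le_integral.
- exact: measurableT.
- by move=> s _; rewrite adde_ge0.
- exact: emeasurable_funD.
- exact: emeasurable_funD.
move=> s _; rewrite -!EFinD lee_fin /direction_likelihood dotNl !mulrN !expRD -!mulrDl.
rewrite ler_wpM2r ?expR_ge0// ler_expRDexpRN// !normrM ler_wpM2r//.
by rewrite !ger0_norm// (le_trans r10).
Qed.

Lemma integral_sphere_radial th (g : R -> R) : measurable_fun [set: R] g ->
  (forall w, (0 <= g w)%R) ->
  \int[sphere_law p]_s ray_integral p th (fun v => (g (sqn p v))%:E) s =
  \int[mu]_(r in half_line R)
    ((radial_density r * g (r ^+ 2))%:E * radial_likelihood th r).
Proof.
move=> mg g0; have mgsqn : measurable_fun setT (fun v : nat -> R => (g (sqn p v))%:E).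
  by apply/measurable_EFinP; apply: (measurableT_comp mg); exact: (measurable_sqn (X := id)).
pose F (z : (nat -> R) * measurableTypeR R) :=
  (radial_density z.2 * g (z.2 ^+ 2) * direction_likelihood th z.1 z.2)%:E.
have mD : measurable (half_line R) by exact: measurable_itv.
have mF : measurable_fun setT F.
  apply/measurable_EFinP; apply: measurable_funM; last exact: measurable_direction_likelihood.
  apply: measurable_funM; first exact: (measurableT_comp measurable_radial_density).
  by apply: (measurableT_comp mg); exact: measurable_funX.
have F0 s r : half_line R r -> 0 <= F (s, r).
  rewrite half_lineE => r0.
  by rewrite lee_fin mulr_ge0 ?expR_ge0// mulr_ge0// ltW// radial_density_gt0.
transitivity (\int[sphere_law p]_s \int[mu]_(r in half_line R) F (s, r)).
  apply: (ge0_eq_integral_sphere_law p0).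
  - by apply: measurable_ray_integral => // v; rewrite lee_fin.
  - exact: (measurable_fun_integral_in mu mD mF F0).
  - by move=> s; apply: ray_integral_ge0 => v; rewrite lee_fin.
  - by move=> s; apply: integral_ge0; exact: F0.
  move=> s s1; apply: eq_integral => r _.
  rewrite polar_density_unit// ray_gauss_likelihood sqnZ s1 mulr1 -EFinM; congr EFin.
  by rewrite /radial_density/=; ring.
rewrite (fubini_tonelli_in (sphere_law p) mu mD mF F0).
apply: eq_integral => r; rewrite mem_half_line => r0.
rewrite -ge0_integralZl//.
- apply/measurable_EFinP.
  exact: (measurable_direction_likelihood _ (X := id) (r := fun=> r)).
- by move=> s _; rewrite lee_fin expR_ge0.
- by rewrite lee_fin mulr_ge0// ltW// radial_density_gt0.
Qed.

Lemma radial_law : exists2 C : R, (0 < C)%R & forall th (g : R -> R),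
  measurable_fun [set: R] g -> (forall w, (0 <= g w)%R) ->
  C%:E * \int[gauss_law th p]_v (g (sqn p v))%:E =
  \int[mu]_(r in half_line R)
    ((radial_density r * g (r ^+ 2))%:E * radial_likelihood th r).
Proof.
have [C C0 polar] := polar_coordinates (R := R) p0; exists C => // th g mg g0.
rewrite -integral_sphere_radial// polar//; last by move=> v; rewrite lee_fin.
apply/measurable_EFinP; apply: (measurableT_comp mg).
exact: (measurable_sqn (X := id)).
Qed.

End radial_likelihood.

(** * Stein's identity and comparison of the risks *)

Section loss.
Context {R : realType} (p : nat).
Implicit Types (y g : R -> R) (th v s : nat -> R).

Definition loss y th v : R :=
  sqn p ((1 - y (sqn p v) / sqn p v) \*o v \- th).

Lemma loss_ge0 y th v : 0 <= loss y th v.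
Proof. exact: sqn_ge0. Qed.

Lemma measurable_loss y th : measurable_fun [set: R] y ->
  measurable_fun setT (loss y th).
Proof.
have msqn : measurable_fun setT (fun v : nat -> R => sqn p v).
  exact: (measurable_sqn (X := id)).
move=> my; apply: measurable_sqn; apply: measurable_translate.
apply: (measurable_scale (X := id)) => //; apply: measurable_funB => //.
by apply: measurable_funM; [exact: (measurableT_comp my msqn)|exact: measurable_funV].
Qed.

Lemma loss_ray y th s r : sqn p s = 1 ->
  loss y th (r \*o s) = ray_loss (y (r ^+ 2)) (dot p s th) (sqn p th) r.
Proof.
move=> s1; rewrite /loss sqnZ s1 mulr1.
have -> : (1 - y (r ^+ 2) / r ^+ 2) \*o (r \*o s) =
    ((1 - y (r ^+ 2) / r ^+ 2) * r) \*o s.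
  by apply/funext => j; rewrite /= mulrA.
by rewrite sqnZB s1 mulr1.
Qed.

Definition compensated_loss y g th v : \bar R :=
  ((loss y th v)%:E + (g (sqn p v))%:E)%E.

Lemma compensated_loss_ge0 y g th v : (forall w, 0 <= g w) ->
  (0 <= compensated_loss y g th v)%E.
Proof. by move=> g0; rewrite adde_ge0// lee_fin ?loss_ge0. Qed.

Lemma measurable_compensated_loss y g th : measurable_fun [set: R] y ->
  measurable_fun [set: R] g -> measurable_fun setT (compensated_loss y g th).
Proof.
move=> my mg; apply: emeasurable_funD; apply/measurable_EFinP.
  exact: measurable_loss.
by apply: (measurableT_comp mg); exact: (measurable_sqn (X := id)).
Qed.

Lemma ray_integral_compensated_loss y g th s : sqn p s = 1 ->
  ray_integral p th (compensated_loss y g th) s =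
  (\int[lebesgue_measure]_(r in half_line R)
    (ray_risk p.-1 y g (dot p s th) (sqn p th) r)%:E)%E.
Proof.
move=> s1; apply: eq_integral => r _.
rewrite /compensated_loss -EFinD -EFinM; congr EFin.
by rewrite polar_density_unit// loss_ray// sqnZ s1 mulr1.
Qed.

Lemma compensated_loss_polar : (0 < p)%N -> exists2 C : R, 0 < C & forall th y g,
  measurable_fun [set: R] y -> measurable_fun [set: R] g -> (forall w, 0 <= g w) ->
  (C%:E * (\int[gauss_law th p]_v (loss y th v)%:E +
           \int[gauss_law th p]_v (g (sqn p v))%:E) =
   \int[sphere_law p]_s ray_integral p th (compensated_loss y g th) s)%E.
Proof.
move=> p0; have [C C0 polar] := polar_coordinates (R := R) p0.
exists C => // th y g my mg g0; rewrite -polar; last 2 first.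
- exact: measurable_compensated_loss.
- by move=> v; exact: compensated_loss_ge0.
rewrite ge0_integralD//.
- by move=> v _; rewrite lee_fin loss_ge0.
- by apply/measurable_EFinP; exact: measurable_loss.
- by move=> v _; rewrite lee_fin.
- apply/measurable_EFinP; apply: (measurableT_comp mg).
  exact: (measurable_sqn (X := id)).
Qed.

End loss.

Section shrinkage.
Context {R : realType} (n : nat) (phi phi' : R -> R).
Local Notation mu := (@lebesgue_measure R).
Local Notation c := (n.+1%:R : R).
Implicit Types a b r w : R.

Hypothesis dphi : forall w, 0 < w -> is_derive w 1 phi (phi' w).
Hypothesis phi'_continuous : forall w, 0 < w -> {for w, continuous phi'}.
Hypothesis phi'_ge0 : forall w, 0 < w -> 0 <= phi' w.
Hypothesis phi_ge0 : forall w, 0 < w -> 0 <= phi w.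
Hypothesis phi_lt : forall w, 0 < w -> phi w < c.

(* Stein's unbiased estimate of the risk difference between the James-Stein
   estimator and the estimator given by phi, as a function of |X|^2. *)
Definition gain w : R := 4 * phi' w - (c - phi w) ^+ 2 / w.

Lemma continuous_gain w : 0 < w -> {for w, continuous gain}.
Proof.
move=> w0; apply: cvgB.
  by apply: cvgM; [exact: cvg_cst|exact: phi'_continuous].
apply: cvgM; last by apply: inv_continuous; rewrite gt_eqF.
apply: (cvg_comp (fun x => c - phi x) (fun y => y ^+ 2)); last exact: exprn_continuous.
by apply: cvgB; [exact: cvg_cst|exact: is_derive1_continuous (dphi w0)].
Qed.

Lemma continuous_gain_funrpos w : 0 < w -> {for w, continuous gain^\+}.
Proof.
by move=> w0; apply: continuous_max; [exact: continuous_gain|exact: cvg_cst].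
Qed.

Lemma continuous_gain_funrneg w : 0 < w -> {for w, continuous gain^\-}.
Proof.
move=> w0; apply: continuous_max; last exact: cvg_cst.
by apply: cvgN; exact: continuous_gain.
Qed.

Lemma gain_funrneg_le w : 0 < w -> gain^\- w <= c ^+ 2 / w.
Proof.
move=> w0; rewrite /funrneg ge_max divr_ge0 ?sqr_ge0 ?(ltW w0)// andbT.
have : (c - phi w) ^+ 2 / w <= c ^+ 2 / w.
  rewrite ler_pM2r ?invr_gt0// ler_sqr ?nnegrE//;
  by have := phi_ge0 w0; have := phi_lt w0; lra.
by have := phi'_ge0 w0; rewrite /gain; lra.
Qed.

Definition ray_primitive a b r : R :=
  2 * (r ^+ n.+1 * (c - phi (r ^+ 2)) * ray_gauss a b r).

Lemma ray_primitive_bounds a b r : 0 < r ->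
  0 <= ray_primitive a b r <= 2 * c * (r ^+ n.+1 * ray_gauss a b r).
Proof.
move=> r0; have r20 := exprn_gt0 2 r0.
have pw := phi_lt r20; have p0 := phi_ge0 r20.
have m0 : 0 <= r ^+ n.+1 * ray_gauss a b r.
  by rewrite mulr_ge0 ?expR_ge0// exprn_ge0// ltW.
have -> : ray_primitive a b r =
    2 * (c - phi (r ^+ 2)) * (r ^+ n.+1 * ray_gauss a b r).
  by rewrite /ray_primitive; ring.
by rewrite mulr_ge0 ?ler_wpM2r//; lra.
Qed.

Lemma ray_primitive_cvg0 a b : ray_primitive a b r @[r --> 0^'+] --> 0.
Proof.
apply: (@squeeze_cvgr _ _ _ _ (fun=> 0)
  (fun r => 2 * c * (r ^+ n.+1 * ray_gauss a b r))).
- by near=> r; apply: ray_primitive_bounds; near: r; exact: nbhs_right_gt.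
- exact: cvg_cst.
- rewrite -[X in _ --> X](mulr0 (2 * c)); apply: cvgM; first exact: cvg_cst.
  exact: exprnS_ray_gauss_cvg0.
Unshelve. all: by end_near. Qed.

Lemma ray_primitive_cvgy a b : a ^+ 2 <= b -> ray_primitive a b r @[r --> +oo] --> 0.
Proof.
move=> ab; apply: (@squeeze_cvgr _ _ _ _ (fun=> 0)
  (fun r => 2 * c * (r ^+ n.+1 * ray_gauss a b r))).
- by near=> r; apply: ray_primitive_bounds; near: r; exact: nbhs_pinfty_gt.
- exact: cvg_cst.
- rewrite -[X in _ --> X](mulr0 (2 * c)); apply: cvgM; first exact: cvg_cst.
  exact: exprn_ray_gauss_cvgy.
Unshelve. all: by end_near. Qed.

(* The divergence of the radial field [(c - phi |x|^2) / |x|^2 x] against the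
   Gaussian density. *)
Lemma is_derive_ray_primitive a b r : 0 < r ->
  is_derive r 1 (ray_primitive a b)
    (ray_risk n.+2 (cst c) gain^\- a b r - ray_risk n.+2 phi gain^\+ a b r).
Proof.
move=> r0; have dphir : is_derive r 1 (fun x : R => phi (x ^+ 2)) (phi' (r ^+ 2) * (2 * r)).
  apply: (@is_derive1_comp _ phi (fun x : R => x ^+ 2)).
    by apply: dphi; exact: exprn_gt0.
  by apply: is_derive_eq; rewrite /GRing.scale/= mulr1 mulr_natl mulr2n.
have dpow := is_deriveX n.+1 (is_derive_id r (1 : R)); rewrite exprfctE in dpow.
have gainE : gain^\+ (r ^+ 2) = gain^\- (r ^+ 2) + gain (r ^+ 2).
  by rewrite -[X in _ + X (r ^+ 2)]funrposBneg/= addrC subrK.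
apply: is_derive_eq (is_deriveZ 2 (is_deriveM (is_deriveM dpow
  (is_deriveB (is_derive_cst c r 1) dphir)) (is_derive_ray_gauss a b r))) _.
rewrite /ray_risk /ray_loss gainE /gain.
move: (gain^\- _) => h; rewrite /GRing.scale/= !fctE !exprS.
by field; rewrite gt_eqF.
Qed.

Lemma integral_ray_risk a b : a ^+ 2 <= b ->
  (\int[mu]_(r in half_line R) (ray_risk n.+2 phi gain^\+ a b r)%:E =
   \int[mu]_(r in half_line R) (ray_risk n.+2 (cst c) gain^\- a b r)%:E)%E.
Proof.
move=> ab; apply: (@eq_integral_half_line_primitive _ _ _ (ray_primitive a b)).
- by move=> r r0; rewrite ray_risk_ge0 ?funrpos_ge0.
- by move=> r r0; rewrite ray_risk_ge0 ?funrneg_ge0.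
- move=> r r0; have r20 := exprn_gt0 2 r0; apply: continuous_ray_risk => //.
    exact: is_derive1_continuous (dphi r20).
  exact: continuous_gain_funrpos.
- move=> r r0; have r20 := exprn_gt0 2 r0; apply: continuous_ray_risk => //.
    exact: cvg_cst.
  exact: continuous_gain_funrneg.
- exact: is_derive_ray_primitive.
- exact: ray_primitive_cvg0.
- exact: ray_primitive_cvgy.
Qed.

Lemma ray_risk_JS_le b : exists2 K, 0 <= K & forall a r, a ^+ 2 <= b -> 0 < r ->
  ray_risk n.+2 (cst c) gain^\- a b r <= K * expR (- r).
Proof.
have [b0|b0] := ltP b 0.
  by exists 0 => // a r ab; have := le_lt_trans ab b0; rewrite ltNge sqr_ge0.
pose K k : R := k`!%:R * expR (b + 3).
have K0 k : 0 <= K k by rewrite mulr_ge0 ?expR_ge0.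
exists (4 * K n.+4 + 5 * c ^+ 2 * K n + 2 * b * K n.+2).
  by rewrite !addr_ge0 ?mulr_ge0 ?sqr_ge0.
move=> a r ab r0; have rn0 : r != 0 by rewrite gt_eqF.
have gauss0 : 0 <= r ^+ n.+2 * ray_gauss a b r.
  by rewrite mulr_ge0 ?expR_ge0// exprn_ge0// ltW.
have loss_le : ray_loss c a b r + gain^\- (r ^+ 2) <=
    4 * r ^+ 2 + 5 * c ^+ 2 / r ^+ 2 + 2 * b.
  have := gain_funrneg_le (exprn_gt0 2 r0); rewrite /ray_loss.
  have -> : (1 - c / r ^+ 2) * r = r - c / r by field.
  have -> : 5 * c ^+ 2 / r ^+ 2 = 5 * (c / r) ^+ 2 by field.
  rewrite -expr_div_n; move: (c / r) (gain^\- _) => t g h.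
  have := sqr_ge0 (r - t + a); have := sqr_ge0 (r + t).
  by rewrite !expr2 in ab h *; lra.
have moment k : r ^+ k * ray_gauss a b r <= K k * expR (- r).
  exact: exprn_ray_gauss_le (ltW r0) ab.
apply: (le_trans (ler_wpM2l gauss0 loss_le)).
have -> : r ^+ n.+2 * ray_gauss a b r *
    (4 * r ^+ 2 + 5 * c ^+ 2 / r ^+ 2 + 2 * b) =
    4 * (r ^+ n.+4 * ray_gauss a b r) + 5 * c ^+ 2 * (r ^+ n * ray_gauss a b r)
    + 2 * b * (r ^+ n.+2 * ray_gauss a b r).
  by rewrite !(exprS r); field.
have -> : (4 * K n.+4 + 5 * c ^+ 2 * K n + 2 * b * K n.+2) * expR (- r) =
    4 * (K n.+4 * expR (- r)) + 5 * c ^+ 2 * (K n * expR (- r))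
    + 2 * b * (K n.+2 * expR (- r)) by ring.
by rewrite !lerD// ler_wpM2l ?moment// mulr_ge0 ?sqr_ge0.
Qed.

Lemma integral_ray_risk_JS_le b : exists2 K, 0 <= K & forall a, a ^+ 2 <= b ->
  (\int[mu]_(r in half_line R) (ray_risk n.+2 (cst c) gain^\- a b r)%:E <= K%:E)%E.
Proof.
have [K K0 risk_le] := ray_risk_JS_le b; exists K => // a ab.
have mexp : measurable_fun (half_line R) (fun r : R => (expR (- r))%:E).
  apply/measurable_EFinP/measurable_funTS/measurable_fun_expR.
  exact: measurable_funN.
rewrite -[leRHS]mule1 -integral_expRN -ge0_integralZl//.
apply: ge0_le_integral => //.
- by move=> r; rewrite half_lineE => r0; rewrite lee_fin ray_risk_ge0 ?funrneg_ge0.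
- apply/measurable_EFinP; apply: open_continuous_measurable_fun => // r.
  rewrite mem_half_line => r0; apply: continuous_ray_risk => //; first exact: cvg_cst.
  by apply: continuous_gain_funrneg; exact: exprn_gt0.
- exact: measurable_funeM.
- by move=> r; rewrite half_lineE => r0; rewrite -EFinM lee_fin risk_le.
Qed.

Hypothesis mphi : measurable_fun [set: R] phi.
Hypothesis mphi' : measurable_fun [set: R] phi'.
Hypothesis gain_ratio_nondecreasing : forall w w', 0 < w -> w <= w' ->
  w * phi' w / (c - phi w) ^+ 2 <= w' * phi' w' / (c - phi w') ^+ 2.
Local Notation p := n.+3.
Implicit Types th : nat -> R.

Lemma measurable_gain : measurable_fun [set: R] gain.
Proof.
apply: measurable_funB; first exact: measurable_funM.
apply: measurable_funM; last exact: measurable_funV.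
by apply: measurable_funX; exact: measurable_funB.
Qed.

Lemma gain_ge0E w : 0 < w ->
  (0 <= gain w) = (4^-1 <= w * phi' w / (c - phi w) ^+ 2).
Proof.
move=> w0; have pw : 0 < c - phi w by have := phi_lt w0; lra.
rewrite /gain subr_ge0 ler_pdivrMr// ler_pdivlMr ?exprn_gt0//.
by apply/idP/idP => ?; lra.
Qed.

Lemma gain_crossing w w' : 0 < w -> w <= w' -> 0 <= gain w -> 0 <= gain w'.
Proof.
move=> w0 ww'; have w'0 := lt_le_trans w0 ww'.
by rewrite !gain_ge0E// => /le_trans; apply; exact: gain_ratio_nondecreasing.
Qed.

Local Open Scope ereal_scope.
Local Notation mean_loss y th := (\int[gauss_law th p]_v (loss p y th v)%:E).
Local Notation mean_radial g th := (\int[gauss_law th p]_v (g (sqn p v))%:E).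

Let mgp : measurable_fun [set: R] gain^\+%R.
Proof. exact: measurable_funrpos measurable_gain. Qed.

Let mgn : measurable_fun [set: R] gain^\-%R.
Proof. exact: measurable_funrneg measurable_gain. Qed.

Lemma stein_identity th :
  mean_loss phi th + mean_radial gain^\+%R th =
  mean_loss (cst c) th + mean_radial gain^\-%R th.
Proof.
have [C C0 polar] := @compensated_loss_polar R p isT; apply: (pmule_inj C0).
rewrite (polar th phi _ mphi mgp (funrpos_ge0 _)).
rewrite (polar th (cst c) _ (measurable_cst _) mgn (funrneg_ge0 _)).
apply: (@ge0_eq_integral_sphere_law R p _ _ isT).
- apply: measurable_ray_integral; first exact: measurable_compensated_loss.
  by move=> v; apply: compensated_loss_ge0; exact: funrpos_ge0.
- apply: measurable_ray_integral; first exact: measurable_compensated_loss.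
  by move=> v; apply: compensated_loss_ge0; exact: funrneg_ge0.
- move=> s; apply: ray_integral_ge0 => v.
  by apply: compensated_loss_ge0; exact: funrpos_ge0.
- move=> s; apply: ray_integral_ge0 => v.
  by apply: compensated_loss_ge0; exact: funrneg_ge0.
move=> s s1; rewrite !ray_integral_compensated_loss//.
by apply: integral_ray_risk; exact: sqr_dot_le.
Qed.

Lemma stein_identity_lty th :
  mean_loss (cst c) th + mean_radial gain^\-%R th < +oo.
Proof.
have [C C0 polar] := @compensated_loss_polar R p isT; apply: (pmule_lty C0).
have [K K0 risk_le] := integral_ray_risk_JS_le (sqn p th).
rewrite (polar th (cst c) _ (measurable_cst _) mgn (funrneg_ge0 _)).
apply: le_lt_trans (ltry K); rewrite -(integral_probability_cst (sphere_law p) K%:E).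
apply: (@ge0_le_integral_sphere_law R p _ _ isT).
- apply: measurable_ray_integral; first exact: measurable_compensated_loss.
  by move=> v; apply: compensated_loss_ge0; exact: funrneg_ge0.
- exact: measurable_cst.
- move=> s; apply: ray_integral_ge0 => v.
  by apply: compensated_loss_ge0; exact: funrneg_ge0.
- by move=> s; rewrite lee_fin.
move=> s s1; rewrite ray_integral_compensated_loss//; apply: risk_le.
exact: sqr_dot_le.
Qed.

Lemma mean_loss_le_gain th :
  (mean_loss phi th <= mean_loss (cst c) th) =
  (mean_radial gain^\-%R th <= mean_radial gain^\+%R th).
Proof.
apply: lee_adde_eqE (stein_identity th) (stein_identity_lty th);
by apply: integral_ge0 => v _; rewrite lee_fin ?loss_ge0 ?funrpos_ge0 ?funrneg_ge0.
Qed.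

(* Monotone likelihood ratio: the likelihood is nondecreasing in the radius while
   the gain changes sign only once, from negative to nonnegative. *)
Lemma mean_radial_gain_le th :
  mean_radial gain^\-%R (fun=> 0%R) <= mean_radial gain^\+%R (fun=> 0%R) ->
  mean_radial gain^\-%R th <= mean_radial gain^\+%R th.
Proof.
have [C C0 radial] := @radial_law R p isT; have le_C := @lee_pmul2l R C%:E isT C0.
pose h r : R := (radial_density p r * gain (r ^+ 2))%R.
have mh : measurable_fun [set: R] h.
  apply: measurable_funM; first exact: measurable_radial_density.
  by apply: (measurableT_comp measurable_gain); exact: measurable_funX.
have mean_neg th' : C%:E * mean_radial gain^\-%R th' =
    \int[mu]_(r in half_line R) ((h^\-%R r)%:E * radial_likelihood p th' r).
  rewrite (radial _ _ mgn (funrneg_ge0 _)); apply: eq_integral => r.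
  rewrite mem_half_line => r0; rewrite /h /funrneg.
  by rewrite -mulrN maxr_pMr ?mulr0// ltW// radial_density_gt0.
have mean_pos th' : C%:E * mean_radial gain^\+%R th' =
    \int[mu]_(r in half_line R) ((h^\+%R r)%:E * radial_likelihood p th' r).
  rewrite (radial _ _ mgp (funrpos_ge0 _)); apply: eq_integral => r.
  rewrite mem_half_line => r0; rewrite /h /funrpos.
  by rewrite maxr_pMr ?mulr0// ltW// radial_density_gt0.
move=> neg_le_pos.
rewrite -(le_C (mean_radial gain^\-%R th)) mean_neg mean_pos.
apply: single_crossing_le_integral.
- exact: mh.
- exact: measurable_radial_likelihood.
- exact: radial_likelihood_ge0.
- exact: radial_likelihood_nondecreasing.
- have central (f : R -> R) : \int[mu]_(r in half_line R) (f r)%:E =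
      \int[mu]_(r in half_line R) ((f r)%:E * radial_likelihood p (fun=> 0%R) r).
    by apply: eq_integral => r _; rewrite radial_likelihood0 mule1.
  by rewrite (central h^\-%R) (central h^\+%R) -mean_neg -mean_pos le_C.
- move=> r s r0 rs; have s0 := lt_le_trans r0 rs.
  rewrite /h (pmulr_rge0 _ (radial_density_gt0 p r0)).
  rewrite (pmulr_rge0 _ (radial_density_gt0 p s0)).
  apply: gain_crossing; first exact: exprn_gt0.
  by rewrite ler_sqr// nnegrE ltW.
Qed.

Lemma mean_loss_dominance :
  mean_loss phi (fun=> 0%R) <= mean_loss (cst c) (fun=> 0%R) ->
  forall th, mean_loss phi th <= mean_loss (cst c) th.
Proof.
move=> le0 th; rewrite (mean_loss_le_gain th); apply: mean_radial_gain_le.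
by rewrite -(mean_loss_le_gain (fun=> 0%R)).
Qed.

End shrinkage.

Section regularity.
Context {R : realType}.
Implicit Types (f phi : R -> R) (w : R).

Lemma near_patch_open (D : set R) f w : open D -> D w -> \near w, f w = (f \_ D) w.
Proof.
move=> oD Dw; near=> x; rewrite patchE mem_set//.
by near: x; exact: open_nbhs_nbhs.
Unshelve. all: by end_near. Qed.

Lemma patch_half_line f w : 0 < w -> (f \_ (half_line R)) w = f w.
Proof. by move=> w0; rewrite patchE mem_set// half_lineE. Qed.

Lemma is_derive_patch_half_line f w (d : R) : 0 < w -> is_derive w 1 f d ->
  is_derive w 1 (f \_ (half_line R)) d.
Proof.
move=> w0; apply: near_eq_is_derive; apply: near_patch_open => //.
by rewrite half_lineE.
Qed.

Lemma continuous_patch_half_line f w : 0 < w -> {for w, continuous f} ->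
  {for w, continuous (f \_ (half_line R))}.
Proof.
move=> w0 cf; rewrite /prop_for /continuous_at patch_half_line//.
apply: cvg_trans cf; apply: near_eq_cvg; apply: near_patch_open => //.
by rewrite half_lineE.
Qed.

Lemma measurable_patch_half_line f : (forall w, 0 < w -> {for w, continuous f}) ->
  measurable_fun [set: R] (f \_ (half_line R)).
Proof.
move=> cf; apply: measurable_patch_open => // w.
by rewrite mem_half_line; exact: cf.
Qed.

(* In the variable t = ln w, the ratio is the derivative of 1 / (c - phi). *)
Lemma continuous_of_ratio_nondecreasing (c : R) phi phi' :
  (forall w, 0 < w -> is_derive w 1 phi (phi' w)) ->
  (forall w, 0 < w -> phi w < c) ->
  (forall w w', 0 < w -> w <= w' ->
    w * phi' w / (c - phi w) ^+ 2 <= w' * phi' w' / (c - phi w') ^+ 2) ->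
  forall w, 0 < w -> {for w, continuous phi'}.
Proof.
move=> dphi phi_lt ratio_nondecreasing.
pose ratio w : R := w * phi' w / (c - phi w) ^+ 2.
have gap w : 0 < w -> c - phi w != 0 by move=> /phi_lt; rewrite subr_eq0 => /gt_eqF ->.
have dinv (t : R) : is_derive t 1 (fun t : R => (c - phi (expR t))^-1) (ratio (expR t)).
  have et0 := expR_gt0 t; have dgap : is_derive t 1 (fun t : R => c - phi (expR t))
      (- (phi' (expR t) * expR t)).
    have dcomp := @is_derive1_comp _ _ _ _ _ _ (dphi _ et0) (is_derive_expR t).
    by apply: is_derive_eq (is_deriveB (is_derive_cst c t 1) dcomp) _; rewrite sub0r.
  apply: is_derive_eq (is_deriveV (f := fun t => c - phi (expR t)) (gap _ et0) dgap) _.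
  by rewrite /ratio /GRing.scale/=; field; exact: gap.
have cratio : continuous (ratio \o expR).
  apply: (nondecreasing_derive_continuous dinv) => s t st.
  by apply: ratio_nondecreasing; rewrite ?expR_gt0 ?ler_expR.
move=> w w0; have cphi : {for w, continuous phi}.
  exact: is_derive1_continuous (dphi w w0).
have phi'E x : 0 < x -> ratio (expR (ln x)) * (c - phi x) ^+ 2 / x = phi' x.
  move=> x0; rewrite lnK ?posrE// /ratio; field.
  by rewrite gap// gt_eqF.
have : (fun x => ratio (expR (ln x)) * (c - phi x) ^+ 2 / x) x @[x --> w] --> phi' w.
  rewrite -phi'E//; apply: cvgM; last by apply: cvgV; [rewrite gt_eqF|exact: cvg_id].
  apply: cvgM.
    exact: (cvg_comp _ _ (continuous_ln w0) (cratio (ln w))).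
  apply: (cvg_comp (fun x => c - phi x) (fun y => y ^+ 2)); last exact: exprn_continuous.
  by apply: cvgB; [exact: cvg_cst|exact: cphi].
apply: cvg_trans; apply: near_eq_cvg; near=> x; apply: phi'E.
by near: x; exact: lt_nbhsr.
Unshelve. all: by end_near. Qed.

End regularity.

Section risk_in_coordinates.
Context {R : realType} (p : nat).
Implicit Types (theta : 'rV[R]_p) (phi : R -> R).

Lemma coordsE theta (i : 'I_p) : coords theta i = theta 0 i.
Proof. by rewrite /coords insubT//= => ilt; congr (theta 0 _); exact: val_inj. Qed.

Lemma coords0 : coords (0 : 'rV[R]_p) = fun=> 0.
Proof.
by apply/funext => j; rewrite /coords; case: insubP => // i _ _; rewrite mxE.
Qed.

Lemma risk_est_phi phi theta : measurable_fun [set: R] phi ->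
  risk theta (est_phi phi) =
  (\int[gauss_law (coords theta) p]_v (loss p phi (coords theta) v)%:E)%E.
Proof.
move=> mphi; rewrite -iter_gaussE; last 2 first.
- by apply/measurable_EFinP; exact: measurable_loss.
- by move=> v; rewrite lee_fin loss_ge0.
congr iter_gauss; apply/funext => v; congr EFin; rewrite /est_phi.
have -> : sqnorm (\row_(i < p) v i) = sqn p v.
  by apply: eq_bigr => i _; rewrite mxE.
by apply: eq_bigr => i _; rewrite !mxE /= coordsE.
Qed.

Lemma est_phi_patch_half_line phi :
  est_phi (phi \_ (half_line R)) = est_phi phi :> ('rV[R]_p -> _).
Proof.
apply/funext => x; rewrite /est_phi; congr ((1 - _) *: _).
have : 0 <= sqnorm x by apply: sumr_ge0 => i _; exact: sqr_ge0.
rewrite le_eqVlt => /orP[/eqP <-|x0]; first by rewrite invr0 !mulr0.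
by rewrite patch_half_line.
Qed.

End risk_in_coordinates.

Lemma risk_dominance {R : realType} (n : nat) (phi : R -> R) :
  (forall w : R, 0 < w -> derivable phi w 1) ->
  (forall w : R, 0 < w -> phi w < n.+1%:R) ->
  (forall w : R, 0 < w -> 0 <= derive1 phi w) ->
  (forall w : R, 0 < w -> 0 <= phi w) ->
  (forall w w' : R, 0 < w -> w <= w' ->
     w * derive1 phi w / (n.+1%:R - phi w) ^+ 2
     <= w' * derive1 phi w' / (n.+1%:R - phi w') ^+ 2) ->
  (risk (0 : 'rV[R]_n.+3) (est_phi phi) <=
   risk (0 : 'rV[R]_n.+3) (est_phi (cst n.+1%:R)))%E ->
  forall theta : 'rV[R]_n.+3,
    (risk theta (est_phi phi) <= risk theta (est_phi (cst n.+1%:R)))%E.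
Proof.
move=> phi_derivable phi_lt dphi_ge0 phi_ge0 ratio risk0 theta.
have dphi (w : R) : 0 < w -> is_derive w 1 phi (derive1 phi w).
  by move=> w0; split; [exact: phi_derivable|rewrite derive1E].
have cdphi := continuous_of_ratio_nondecreasing dphi phi_lt ratio.
have mphi : measurable_fun [set: R] (phi \_ (half_line R)).
  by apply: measurable_patch_half_line => w w0; exact: is_derive1_continuous (dphi w w0).
have mcst : measurable_fun [set: R] (cst (n.+1%:R : R)) by exact: measurable_cst.
move: risk0; rewrite -(est_phi_patch_half_line _ phi).
rewrite (risk_est_phi 0 mphi) (risk_est_phi 0 mcst) coords0 => risk0.
rewrite (risk_est_phi theta mphi) (risk_est_phi theta mcst).
apply: (@mean_loss_dominance R n (phi \_ (half_line R)) (derive1 phi \_ (half_line R)));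
  last exact: risk0.
- move=> w w0; rewrite patch_half_line//; apply: is_derive_patch_half_line => //.
  exact: dphi.
- by move=> w w0; apply: continuous_patch_half_line => //; exact: cdphi.
- by move=> w w0; rewrite patch_half_line// dphi_ge0.
- by move=> w w0; rewrite patch_half_line// phi_ge0.
- by move=> w w0; rewrite patch_half_line// phi_lt.
- exact: mphi.
- exact: measurable_patch_half_line cdphi.
- move=> w w' w0 ww'; have w'0 := lt_le_trans w0 ww'.
  by rewrite !patch_half_line//; exact: ratio.
Qed.

Theorem theorem1 (R : realType) (p : nat) (phi : R -> R) :
  (3 <= p)%N ->
  (* phi differentiable on [0, oo): two-sided on (0, oo), right at 0 *)
  (forall w : R, 0 < w -> derivable phi w 1) ->
  (* (A.1) at w = 0: the right derivative exists and is >= 0 *)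
  (exists d : R, 0 <= d /\
     (fun h : R => h^-1 * (phi h - phi 0)) @ 0^'+ --> d) ->
  (forall w : R, 0 < w -> phi w < (p - 2)%:R) ->
  (* (A.1) for w > 0 *)
  (forall w : R, 0 < w -> 0 <= derive1 phi w) ->
  (* (A.2) *)
  (forall w : R, 0 <= w -> 0 <= phi w) ->
  (* (A.4) *)
  phi x @[x --> +oo] --> ((p - 2)%:R : R) ->
  (* (A.6) *)
  (forall w1 w2 : R, 0 < w1 -> w1 <= w2 ->
     w1 * derive1 phi w1 / ((p - 2)%:R - phi w1) ^+ 2
     <= w2 * derive1 phi w2 / ((p - 2)%:R - phi w2) ^+ 2) ->
  (* (A.7) *)
  (risk (0 : 'rV[R]_p) (est_phi phi) <= risk 0 (@est_JS R p))%E ->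
  forall theta : 'rV[R]_p,
    (risk theta (est_phi phi) <= risk theta (@est_JS R p))%E.
Proof.
move=> p3; have [n ->] : exists n, p = n.+3 by exists (p - 3)%N; rewrite -addn3 subnK.
move=> phi_derivable _ phi_lt dphi_ge0 phi_ge0 _ ratio risk0.
apply: (risk_dominance phi_derivable phi_lt dphi_ge0 _ ratio risk0) => w /ltW.
exact: phi_ge0.
Qed.
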